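(* Let $1<p<r\le\infty$, let $r'$ be the conjugate index of $r$, $\frac1r+\frac1{r'}=1$, and define $v$ by $\frac1v=\frac1p-\frac1r$. Let $m:(0,1]\to\mathbb{C}$ be continuous with $m\in L^v[0,1]$, and suppose that $m$ is absolutely continuous on $[\epsilon,1]$ for all $\epsilon\in(0,1)$ and that $$\sum_{n=1}^\infty\left(2^{-n/r'}\|P_nm'\|_p\right)^p<\infty,\qquad\text{where } P_nm'=m'\cdot\chi_{(2^{-n},2^{-n+1}]}.$$ Then $Tg=mg$ defines a multiplier from $AC_r$ to $AC_p$.
   Context: For $1\le p\le\infty$, $AC_p$ denotes the algebra (under pointwise operations) of absolutely continuous functions $f:[0,1]\to\mathbb{C}$ with $f(0)=0$ and $f'\in L^p[0,1]$, with norm $|||f|||=\|f'\|_p$. A multiplier $T:AC_r\to AC_p$ is a map given by a continuous (not necessarily bounded) function $m:(0,1]\to\mathbb{C}$ via $Tg=mg$, where $mg\in AC_p$ for every $g\in AC_r$; here $mg$ denotes the function on $[0,1]$ equal to $m(t)g(t)$ for $t\in(0,1]$ and to $0$ at $t=0$. $\chi_E$ is the indicator function of $E$; $1/\infty=0$, so for $r=\infty$ one has $r'=1$ and $v=p$. *)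

(* Defs.v *)
(* MathComp-Analysis over an arbitrary [R : realType]; C is [R[i]]. *)
From HB Require Import structures.
From mathcomp Require Import all_boot all_order all_algebra complex.
From mathcomp Require Import all_classical all_reals all_analysis.

Set Implicit Arguments.
Unset Strict Implicit.
Unset Printing Implicit Defensive.

Import Order.TTheory GRing.Theory Num.Theory.
Import numFieldNormedType.Exports.

Local Open Scope classical_set_scope.
Local Open Scope ring_scope.
Local Open Scope complex_scope.

(* Conventions.  A function on a subset of [0,1] is a total function
   [R -> R[i]] of which only the values on that subset matter.  The topology of
   C is carried by the alias [R[i]^o]; the real-valued modulus is
   [Normc.normc]. *)

Definition abs_continuous (R : realType) (a b : R) (f : R -> R[i]) : Prop :=
  forall e : R, 0 < e -> exists2 d : R, 0 < d &
    forall (n : nat) (s t : 'I_n -> R),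
      (forall i, [&& a <= s i, s i <= t i & t i <= b]) ->
      trivIset setT (fun i => `]s i, t i[%classic) ->
      \sum_(i < n) (t i - s i) < d ->
      \sum_(i < n) Normc.normc (f (t i) - f (s i)) < e.

(* [derive1] requires a codomain normed over [R], whereas [R[i]^o] is normed
   over [R[i]].  Where the limit does not exist the value is arbitrary; an
   absolutely continuous function is differentiable almost everywhere. *)
Definition cderive (R : realType) (f : R -> R[i]) (x : R) : R[i] :=
  lim (((h%:C)^-1 * (f (x + h) - f x) : R[i]^o) @[h --> 0^']).

Definition Lp_norm (R : realType) (p : \bar R) (f : R -> R[i]) : \bar R :=
  'N[@lebesgue_measure R]_p
    [(fun x : R => (Normc.normc (f x))%:E) \_ (`[0%R, 1%R]%classic : set R)]%E.

(* The library's sigma-algebra on [R] is the Borel one; a function is Lebesgue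
   measurable iff it agrees almost everywhere with a Borel function. *)
Definition in_Lp (R : realType) (p : \bar R) (f : R -> R[i]) : Prop :=
  exists g : R -> R[i],
    [/\ measurable_fun (`[0%R, 1%R]%classic : set R) (fun x => complex.Re (g x)),
        measurable_fun (`[0%R, 1%R]%classic : set R) (fun x => complex.Im (g x)),
        {ae @lebesgue_measure R, forall x, `[0, 1]%classic x -> f x = g x}
      & (Lp_norm p g < +oo)%E].

Definition in_AC (R : realType) (p : \bar R) (f : R -> R[i]) : Prop :=
  [/\ abs_continuous 0 1 f, f 0 = 0 & in_Lp p (cderive f)].

Definition mult_op (R : realType) (m g : R -> R[i]) (t : R) : R[i] :=
  if t == 0 then 0 else m t * g t.

Definition is_multiplier (R : realType) (r p : \bar R) (m : R -> R[i]) : Prop :=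
  {within `]0, 1]%classic, continuous (m : R -> R[i]^o)} /\
  forall g : R -> R[i], in_AC r g -> in_AC p (mult_op m g).

Definition dyadic_part (R : realType) (n : nat) (f : R -> R[i]) (t : R) : R[i] :=
  f t * (\1_(`]2 ^ (- n%:Z), 2 ^ (- n%:Z + 1)]%classic) t)%:C.

(* Main.v *)
Require Import Defs.
From HB Require Import structures.
From mathcomp Require Import all_boot all_order all_algebra complex.
From mathcomp Require Import all_classical all_reals all_analysis.
From mathcomp Require Import measurable_realfun ess_sup_inf ring lra.

(** An absolutely continuous function is the indefinite integral of its almost
    everywhere derivative.  (Its total variation [V] and [V - f] are
    nondecreasing and absolutely continuous, so their Stieltjes measures are
    dominated by the Lebesgue measure; take Radon-Nikodym densities and apply
    the Lebesgue differentiation theorem.)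

    Let [h = m g].  Away from [0] one has [h' = m' g + m g'].  Since
    [|g t| <= C t^(1/r')], on the [n]-th dyadic interval [m' g] is bounded by
    [2^(-n/r') |m'|] up to a constant, so the series hypothesis says exactly
    that [m' g] is in [L^p]; and [m g'] is in [L^p] because
    [1/p = 1/v + 1/r].  Hence [h'] is in [L^p], thus in [L^1], and [h] is
    absolutely continuous on [0,1] as soon as [|h|] takes arbitrarily small
    values near [0].  Otherwise [|m t| >= c t^(-1/r')] near [0], contradicting
    that [m] is in [L^v], because [v > r'] (this is where [p > 1] is used). *)

Set Implicit Arguments.
Unset Strict Implicit.
Unset Printing Implicit Defensive.

Import Order.TTheory GRing.Theory Num.Theory.
Import numFieldNormedType.Exports.

Local Open Scope classical_set_scope.
Local Open Scope ring_scope.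
Local Open Scope complex_scope.

(** * Real absolutely continuous functions *)

Section real_abs_continuity.
Context {R : realType}.
Implicit Types (a b : R) (f : R -> R).

(** Only finiteness of integrals and smallness near 0 matter, never sharp constants. So no complex
    integral is formed: a complex function is controlled through the moduli of its increments,
    bounded by the integral of twice the modulus of a density, and Hölder's inequality gives way to
    pointwise inequalities between powers that are then integrated. The obstacle is measurability.
    [cderive] takes arbitrary values where its limit fails, and [in_Lp] gives only a Borel function
    that is equal to the given one almost everywhere. The estimates are therefore made on measurable
    representatives, tied to the derivatives by [is_cderive] almost everywhere. The comparison with
    the norms of [cderive m] in the series hypothesis goes through a lower integral. *)

Definition ac_on a b f : Prop :=
  forall e : R, 0 < e -> exists2 d : R, 0 < d &
    forall (n : nat) (s t : 'I_n -> R),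
      (forall i, [&& a <= s i, s i <= t i & t i <= b]) ->
      trivIset setT (fun i => `]s i, t i[%classic) ->
      \sum_(i < n) (t i - s i) < d ->
      \sum_(i < n) `|f (t i) - f (s i)| < e.

(** Subdividing several intervals at once yields a family indexed by pairs (interval, piece); an
    arbitrary finite index type spares a numbering of these pairs. *)
Lemma ac_on_finType a b f : ac_on a b f ->
  forall e : R, 0 < e -> exists2 d : R, 0 < d &
    forall (I : finType) (s t : I -> R),
      (forall i, [&& a <= s i, s i <= t i & t i <= b]) ->
      trivIset setT (fun i => `]s i, t i[%classic) ->
      \sum_i (t i - s i) < d ->
      \sum_i `|f (t i) - f (s i)| < e.
Proof.
move=> acf e e0; have [d d0 fd] := acf e e0; exists d => // I s t st tri std.
have := fd _ (s \o enum_val) (t \o @enum_val I predT).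
rewrite -(reindex (@enum_val I predT) (P := predT) (F := fun i => t i - s i)) /=;
  last first.
  exact/onW_bij/enum_val_bij.
rewrite -(reindex (@enum_val I predT) (P := predT)
  (F := fun i => `|f (t i) - f (s i)|)) /=; last first.
  exact/onW_bij/enum_val_bij.
apply => // i j _ _ ij; apply: enum_val_inj; exact: tri.
Qed.

Lemma itv_partition_nth_lt a b l i j : itv_partition a b l ->
  (i < j <= size l)%N -> nth b (a :: l) i < nth b (a :: l) j.
Proof.
move=> [pl _] /andP[ij js].
by apply: (sorted_ltn_nth lt_trans b (s := a :: l)) => //;
  rewrite inE/= ltnS// ltnW// (leq_trans ij).
Qed.

Lemma itv_partition_nth_leS a b l i : itv_partition a b l ->
  (i < size l)%N -> nth b (a :: l) i <= nth b (a :: l) i.+1.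
Proof. by move=> abl il; apply/ltW/itv_partition_nth_lt => //; rewrite ltnSn. Qed.

(** Partitioning the intervals changes neither their total length nor the disjointness of the
    pieces, so the same [d] serves for the pieces. *)
Lemma ac_on_variation a b f : ac_on a b f ->
  forall e : R, 0 < e -> exists2 d : R, 0 < d &
    forall (n : nat) (s t : 'I_n -> R) (l : 'I_n -> seq R),
      (forall i, [&& a <= s i, s i <= t i & t i <= b]) ->
      trivIset setT (fun i => `]s i, t i[%classic) ->
      \sum_(i < n) (t i - s i) < d ->
      (forall i, itv_partition (s i) (t i) (l i)) ->
      \sum_(i < n) variation (s i) (t i) f (l i) < e.
Proof.
move=> acf e e0; have [d d0 fd] := ac_on_finType acf e0; exists d => //.
move=> n s t l st tri std stl.
pose J (i : 'I_n) : finType := 'I_(size (l i)).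
pose u (p : {i : 'I_n & J i}) := nth (t (tag p)) (s (tag p) :: l (tag p)) (tagged p).
pose w (p : {i : 'I_n & J i}) := nth (t (tag p)) (s (tag p) :: l (tag p)) (tagged p).+1.
have su p : s (tag p) <= u p.
  apply: itv_partition_nth_ge (stl (tag p)); exact: (leq_trans (ltn_ord (tagged p))).
have wt p : w p <= t (tag p).
  by apply: itv_partition_nth_le (stl (tag p)); rewrite ltnS;
    exact: (ltn_ord (tagged p)).
have uw p : u p <= w p by apply: itv_partition_nth_leS => //;
  exact: (ltn_ord (tagged p)).
have sumE (F : 'I_n -> nat -> R) : \sum_(p : {i : 'I_n & J i}) F (tag p) (tagged p) =
    \sum_(i < n) \sum_(0 <= k < size (l i)) F i k.
  under [RHS]eq_bigr do rewrite big_mkord.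
  by rewrite (sig_big_dep _ _ (fun i (j : J i) => F i j)).
have -> : \sum_(i < n) variation (s i) (t i) f (l i) = \sum_p `|f (w p) - f (u p)|.
  by rewrite (sumE (fun i k => `|f (nth (t i) (s i :: l i) k.+1) - f (nth (t i) (s i
    :: l i) k)|)).
apply: fd.
- move=> p; have /and3P[h1 _ h3] := st (tag p).
  by rewrite uw (le_trans h1 (su p)) (le_trans (wt p)).
(* Two pieces with a common point lie in the same interval by [tri]; within it, monotonicity of the
   partition points forces equal positions. *)
- move=> p q _ _ [x [/=]]; rewrite !in_itv/= => /andP[up wp] /andP[uq wq].
  have pq : tag p = tag q.
    apply: tri => //; exists x; split => /=; rewrite in_itv/=.
      by rewrite (le_lt_trans (su p))// (lt_le_trans wp).
    by rewrite (le_lt_trans (su q))// (lt_le_trans wq).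
  move: p q pq up wp uq wq => [i p] [j q] /=; rewrite /u /w/= => ij.
  move: j ij p q => _ <- p q up wp uq wq; congr existT; apply/val_inj => /=.
  have key (k m : nat) : (m < size (l i))%N ->
      nth (t i) (s i :: l i) m < x -> x < nth (t i) (s i :: l i) k.+1 -> (m <= k)%N.
    move=> ml mx xk; rewrite leqNgt; apply/negP => km.
    have := lt_trans mx xk; apply/negP; rewrite -leNgt.
    move: km; rewrite leq_eqVlt => /predU1P[->//|km]; apply/ltW.
    by apply: itv_partition_nth_lt => //; rewrite km ltnW.
  have pl : (nat_of_ord p < size (l i))%N := ltn_ord p.
  have ql : (nat_of_ord q < size (l i))%N := ltn_ord q.
  by apply: anti_leq; apply/andP; split;
    [exact: (key q p pl up wq)|exact: (key p q ql uq wp)].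
- rewrite (sumE (fun i k => nth (t i) (s i :: l i) k.+1 - nth (t i) (s i :: l i) k)).
  apply: le_lt_trans std; apply: ler_sum => i _.
  rewrite (telescope_sumr (fun k => nth (t i) (s i :: l i) k))// .
  by rewrite (itv_partition_nth_size _ (stl i)).
Qed.

Lemma ac_on_total_variation a b f : ac_on a b f ->
  forall e : R, 0 < e -> exists2 d : R, 0 < d &
    forall (n : nat) (s t : 'I_n -> R),
      (forall i, [&& a <= s i, s i <= t i & t i <= b]) ->
      trivIset setT (fun i => `]s i, t i[%classic) ->
      \sum_(i < n) (t i - s i) < d ->
      (forall i, bounded_variation (s i) (t i) f) /\
      \sum_(i < n) fine (total_variation (s i) (t i) f) < e.
Proof.
(* One half of [e] pays for the variations along chosen partitions, the other half, shared among the
   [n] intervals, for the distance of each to its supremum. *)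
move=> acf e e0; have e20 : 0 < e / 2 by rewrite divr_gt0.
have [d d0 fd] := ac_on_variation acf e20; exists d => //.
move=> n s t st tri std.
have stW i : s i <= t i by have /and3P[] := st i.
have bv i : bounded_variation (s i) (t i) f.
  exists (e / 2) => _ [l stl] <-; apply/ltW.
  have /= := fd 1%N (fun=> s i) (fun=> t i) (fun=> l).
  rewrite !big_ord1; apply => //.
    by move=> x y _ _ _; rewrite !ord1.
  apply: le_lt_trans std; rewrite (bigD1 i)//= lerDl sumr_ge0// => j _.
  by rewrite subr_ge0.
split => //.
have [n0|n0] := posnP n.
  by move: s t st tri std stW bv; rewrite n0 => *; rewrite big_ord0.
have en0 : 0 < e / 2 / n%:R by rewrite divr_gt0// ltr0n.
have /choice[l hl] : forall i, exists l, itv_partition (s i) (t i) l /\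
    fine (total_variation (s i) (t i) f) <= variation (s i) (t i) f l + e / 2 / n%:R.
  move=> i; have := stW i; rewrite le_eqVlt => /predU1P[->|sti].
    exists [::]; split; first by split.
    by rewrite total_variationxx/= variation_nil add0r ltW.
  rewrite /total_variation ereal_sup_EFin; [|exact: bv|exact: variations_neq0].
  have /= := sup_adherent en0 (conj (variations_neq0 f sti) (bv i)).
  move=> [_ [l pl <-]] hl; exists l; split => //.
  by rewrite -lerBlDr ltW.
apply: (@le_lt_trans _ _ (\sum_i (variation (s i) (t i) f (l i) + e / 2 / n%:R))).
  by apply: ler_sum => i _; exact: (hl i).2.
have eE : e / 2 / n%:R *+ n = e / 2.
  by rewrite -[LHS]mulr_natr divfK// pnatr_eq0 -lt0n.
rewrite big_split/= sumr_const card_ord eE.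
rewrite [ltRHS](splitr e) ltrD2r; apply: fd => // i; exact: (hl i).1.
Qed.

Lemma ac_on_continuous a b f : ac_on a b f ->
  forall e : R, 0 < e -> exists2 d : R, 0 < d &
    forall x y, a <= x <= b -> a <= y <= b -> `|x - y| < d -> `|f x - f y| < e.
Proof.
move=> acf e e0; have [d d0 fd] := acf e e0; exists d => // x y.
wlog yx : x y / y <= x.
  move=> H xab yab; have /orP[xy|yx] := le_total x y; last exact: H.
  by rewrite distrC => xyd; rewrite distrC; exact: H.
move=> /andP[ax xb] /andP[ay yb] xyd.
have := fd 1%N (fun=> y) (fun=> x); rewrite !big_ord1; apply.
- by move=> _; rewrite ay yx.
- by move=> i j _ _ _; rewrite !ord1.
- by rewrite (le_lt_trans _ xyd)// ler_norm.
Qed.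

(** The variation is finite on every interval shorter than [d], and finitely many of these cover the
    whole interval. *)
Lemma ac_on_bounded_variation a b f : a <= b -> ac_on a b f -> bounded_variation a b f.
Proof.
move=> ab acf; have [d d0 fd] := ac_on_total_variation acf (@ltr01 R).
have step x y : a <= x -> x <= y -> y <= b -> y - x < d -> bounded_variation x y f.
  move=> ax xy yb xyd; have /= := fd 1%N (fun=> x) (fun=> y).
  rewrite !big_ord1 => -[]// => [_|i j _ _ _|h _]; rewrite ?ax ?xy//.
    by rewrite !ord1.
  exact: (h ord0).
(* Consecutive points are at most [d / 2] apart, hence closer than [d]; the minimum stops the walk
   at [b], which is reached after finitely many steps. *)
pose c : nat -> R := fun n => Num.min b (a + n%:R * (d / 2)).
have bvc n : bounded_variation a (c n) f.
  elim: n => [|n ih].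
    have -> : c 0%N = a by rewrite /c mul0r addr0; apply/min_idPr.
    exact: bounded_variationxx.
  have ac k : a <= c k by rewrite /c le_min ab lerDl mulr_ge0// divr_ge0// ltW.
  have cc : c n <= c n.+1.
    by rewrite /c le_min !ge_min lexx/= lerD2l ler_wpM2r ?ler_nat ?leqnSn ?orbT//
      divr_ge0// ltW.
  have cb k : c k <= b by rewrite /c ge_min lexx.
  apply/bounded_variationP => //; rewrite (total_variationD f (ac n) cc) fin_numD.
  apply/andP; split; apply/bounded_variationP => //; apply: step => //.
  rewrite ltrBlDl {1}/c [ltRHS]addrC.
  rewrite gt_min; have [/ltW|] := ltP b (a + n%:R * (d / 2)).
    move=> h; apply/orP; left; rewrite /c; move/min_idPl : h => ->.
    by rewrite ltrDr.
  move=> h; apply/orP; right; rewrite /c; move/min_idPr : h => ->.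
  rewrite -natr1 mulrDl mul1r addrA addrC ltrD2r.
  by rewrite ltr_pdivrMr// ltr_pMr// ltrDl.
pose N := Num.bound ((b - a) / (d / 2)).
suff -> : b = c N by exact: bvc.
apply/esym/min_idPl; rewrite -lerBlDl -ler_pdivrMr ?divr_gt0//.
by rewrite ltW// archi_boundP// divr_ge0 ?subr_ge0// ltW// divr_gt0.
Qed.

Lemma ac_on_tv a b f : a <= b -> ac_on a b f ->
  ac_on a b (fun x => fine (total_variation a x f)).
Proof.
move=> ab acf e e0; have [d d0 fd] := ac_on_total_variation acf e0; exists d => //.
move=> n s t st tri std; have [_] := fd n s t st tri std.
apply: le_lt_trans; apply: ler_sum => i _.
have /and3P[as_ sti tb] := st i.
have bvb := ac_on_bounded_variation ab acf.
have ft : total_variation a (t i) f \is a fin_num.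
  apply/bounded_variationP; [lra|].
  by apply: bounded_variationl bvb; lra.
have := total_variationD f as_ sti => tE; move: ft; rewrite tE fin_numD => /andP[f1 f2].
rewrite fineD// addrC addKr ger0_norm//.
by rewrite fine_ge0// total_variation_ge0.
Qed.

Lemma ac_onB a b f g : ac_on a b f -> ac_on a b g -> ac_on a b (fun x => f x - g x).
Proof.
move=> acf acg e e0; have e20 : 0 < e / 2 by rewrite divr_gt0.
have [d d0 fd] := acf _ e20; have [c c0 gc] := acg _ e20.
exists (Num.min d c) => [|n s t st tri]; first by rewrite lt_min d0.
rewrite lt_min => /andP[std stc].
apply: (@le_lt_trans _ _ (\sum_(i < n) (`|f (t i) - f (s i)| + `|g (t i) - g (s i)|))).
  apply: ler_sum => i _;
    rewrite (_ : _ - _ = (f (t i) - f (s i)) - (g (t i) - g (s i))).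
    exact: ler_normB.
  by rewrite !opprB !addrA; ring.
by rewrite big_split/= [ltRHS]splitr ltrD ?fd ?gc.
Qed.

End real_abs_continuity.

Lemma lebesgue_stieltjes_measure_itv_oc (R : realType) (f : cumulative R R) (x y : R) :
  x <= y -> lebesgue_stieltjes_measure f `]x, y]%classic = (f y - f x)%:E.
Proof.
move=> xy.
rewrite /lebesgue_stieltjes_measure /measure_extension measurable_mu_extE/=.
  by rewrite wlength_itv_bnd.
exact: is_ocitv.
Qed.

(** Used for the components of an open set cut by []a, b]]: whether they contain their ends is
    unknown, and being caught between an open and a closed interval with the same ends is enough. *)
Lemma bounded_interval_ends (R : realType) (a b : R) (J : set R) :
  a <= b -> is_interval J -> J `<=` `[a, b]%classic ->
  exists s t, [/\ [&& a <= s, s <= t & t <= b], `]s, t[%classic `<=` J &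
                 J `<=` `[s, t]%classic].
Proof.
move=> ab iJ Jab; have [->|/set0P[c Jc]] := eqVneq J set0.
  by exists a, a; split => //; [rewrite lexx|rewrite set_itvoo0].
have lJ : has_inf J.
  by split; [exists c|exists a => x /Jab/=; rewrite in_itv/= => /andP[]].
have uJ : has_sup J.
  by split; [exists c|exists b => x /Jab/=; rewrite in_itv/= => /andP[]].
have infx x : J x -> inf J <= x by move=> Jx; exact: (ge_inf lJ.2).
have supx x : J x -> x <= sup J by move=> Jx; exact: (ub_le_sup uJ.2).
exists (inf J), (sup J); split.
- rewrite (le_trans (infx c Jc) (supx c Jc)) andTb; apply/andP; split.
    by apply: lb_le_inf; [exists c|move=> x /Jab/=; rewrite in_itv/= => /andP[]].
  by apply: ge_sup; [exists c|move=> x /Jab/=; rewrite in_itv/= => /andP[]].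
- move=> z /=; rewrite in_itv/= => /andP[iz zs].
  have [x Jx xz] := inf_lt lJ.1 iz; have [y Jy zy] := sup_gt uJ.1 zs.
  by apply: (iJ x y) => //; rewrite !ltW.
- by move=> z Jz /=; rewrite in_itv/= infx ?supx.
Qed.

(** * Densities of monotone absolutely continuous functions *)

Section monotone_density.
Context {R : realType}.
Variables (a b : R) (F : R -> R).
Hypothesis ab : a <= b.
Hypothesis ndF : {in `[a, b] &, nondecreasing_fun F}.
Hypothesis acF : ac_on a b F.

(** Retraction of the line onto [[a, b]]. Composing with it turns [F] into a function that is
    monotone and continuous everywhere, as a Stieltjes measure requires. *)
Let cl (x : R) : R := Num.max a (Num.min x b).

Let cl_itv x : a <= cl x <= b.
Proof. by rewrite /cl le_max lexx ge_max ab ge_min lexx orbT. Qed.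

Let cl_id x : a <= x <= b -> cl x = x.
Proof. by move=> /andP[ax xb]; rewrite /cl (min_idPl xb); apply/max_idPr. Qed.

Let cl_le x y : x <= y -> cl x <= cl y.
Proof.
move=> xy; rewrite /cl ge_max !le_max lexx/=; apply/orP; right.
by rewrite le_min !ge_min xy lexx orbT.
Qed.

Let cl_lip x y : `|cl x - cl y| <= `|x - y|.
Proof.
wlog yx : x y / y <= x.
  move=> H; have /orP[xy|/H//] := le_total x y.
  by rewrite distrC (distrC x); exact: H.
rewrite !ger0_norm ?subr_ge0 ?cl_le// lerBlDr addrC /cl ge_max.
have ? : a <= Num.max a (Num.min y b) by rewrite le_max lexx.
have ? : Num.min y b <= Num.max a (Num.min y b) by rewrite le_max lexx orbT.
suff : Num.min x b <= Num.min y b + (x - y) by move=> ?; apply/andP; split; lra.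
have [?|?] := leP y b; have [?|?] := leP x b; lra.
Qed.

Let G x := F (cl x).

Let ndG : nondecreasing G.
Proof. by move=> x y xy; apply: ndF; rewrite ?in_itv/= ?cl_itv// cl_le. Qed.

Let cG : continuous G.
Proof.
move=> x; apply/cvgrPdist_lt => e e0; have [d d0 fd] := ac_on_continuous acF e0.
apply/nbhs_ballP; exists d => // y xyd; apply: fd => //.
exact: le_lt_trans (cl_lip _ _) xyd.
Qed.


Let nuE := isCumulative.Build R _ R G ndG (right_continuousW cG).
Let Gc : cumulative R R := HB.pack G nuE.

Let nu : {measure set (measurableTypeR R) -> \bar R} :=
  lebesgue_stieltjes_measure Gc.
Local Notation mu := (@lebesgue_measure R).

Let nu_oc x y : x <= y -> nu `]x, y]%classic = (G y - G x)%:E.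
Proof.
exact: (lebesgue_stieltjes_measure_itv_oc Gc).
Qed.

(** Continuity of [G] excludes an atom at [x]: enlarge to []x - d / 2, y]] at a cost below any
    [e]. *)
Let nu_cc x y : x <= y -> (nu `[x, y]%classic <= (G y - G x)%:E)%E.
Proof.
move=> xy; apply/lee_addgt0Pr => e e0.
have /cvgrPdist_lt/(_ e e0)[d/= d0 dG] := @cG x.
apply: (@le_trans _ _ (nu `]x - d / 2, y]%classic)).
  apply: (le_measure nu); rewrite ?inE; [exact: measurable_itv..|].
  by apply: subset_itv; rewrite bnd_simp//; lra.
rewrite nu_oc; last by lra.
rewrite -EFinD lee_fin.
have /= : `|G x - G (x - d / 2)| < e.
  by apply: dG => /=; rewrite opprB addrC subrK gtr0_norm; lra.
by move=> /(le_lt_trans (ler_norm _)); lra.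
Qed.

Let D : set (measurableTypeR R) := `]a, b]%classic.

Let mD : measurable D. Proof. exact: measurable_itv. Qed.

Let nuD : (nu D < +oo)%E. Proof. by rewrite /D nu_oc// ltry. Qed.

Let nuf : {finite_measure set (measurableTypeR R) -> \bar R} := mfrestr mD nuD.

(** A null set lies in an open set of measure less than [d]. The components of that open set are
    disjoint intervals of total length below [d], over which absolute continuity makes the
    increments of [F], hence the Stieltjes mass, at most [e]. *)
Let nuf_dominated : nuf `<< mu.
Proof.
apply/null_content_dominatesP => A mA muA0; apply/eqP; rewrite eq_le measure_ge0 andbT.
apply/lee_addgt0Pr => e e0; rewrite add0e.
have [d d0 fd] := acF e0.
have [|U [oU AU mUA]] := @lebesgue_regularity_outer R A d mA _ d0.
  by rewrite muA0 ltry.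
have mU : measurable U by exact: open_measurable.
have muU : (mu U < d%:E)%E.
  rewrite -(setDUK AU) measureU//; [|exact: measurableD|by rewrite setDIK].
  by rewrite [X in (X + _)%E]muA0 add0e.
apply: (@le_trans _ _ (nuf U)); first by apply: (le_measure nuf); rewrite ?inE.
pose J k := open_disjoint_itv oU k `&` D.
have mJ k : measurable (J k).
  by apply: measurableI => //; apply: open_measurable; exact: open_disjoint_itv_open.
have tJ : trivIset setT J.
  by apply: trivIset_setIr; exact: open_disjoint_itv_trivIset.
have iJ k : is_interval (J k).
  move=> x y [Jx Dx] [Jy Dy] z xzy; split.
    exact: (open_disjoint_itv_is_interval Jx Jy).
  exact: (@interval_is_interval _ `]a, b] _ _ Dx Dy).
have UDE : U `&` D = \bigcup_k J k.
  by rewrite {1}(open_disjoint_itv_bigcup oU) setI_bigcupl.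
have /choice[s] : forall k, exists s, exists t, [/\ [&& a <= s, s <= t & t <= b],
  `]s, t[%classic `<=` J k &
                 J k `<=` `[s, t]%classic].
  by move=> k; apply: bounded_interval_ends => // x [_]; exact: subset_itv_oc_cc.
move=> /choice[t] st.
have -> : nuf U = (\sum_(0 <= k <oo) nu (J k))%E.
  change (nu (U `&` D) = (\sum_(0 <= k <oo) nu (J k))%E).
  rewrite UDE; apply: (measure_semi_bigcup nu mJ tJ).
  by apply: bigcup_measurable => k _; exact: mJ.
(* Absolute continuity speaks of finite families only, so the partial sums are bounded and the bound
   passes to the limit. *)
apply: lime_le.
  by apply: is_cvg_nneseries => *; exact: measure_ge0.
apply: nearW => n.
apply: (@le_trans _ _ (\sum_(0 <= k < n) (F (t k) - F (s k))%:E)).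
  apply: lee_sum => k _.
  have [/and3P[ask skt tkb] _ Jst] := st k.
  apply: (@le_trans _ _ (nu `[s k, t k]%classic)).
    apply: (le_measure nu) => //; rewrite inE; [exact: mJ|exact: measurable_itv].
  apply: (le_trans (nu_cc skt)); rewrite /G !cl_id//; lra.
rewrite sumEFin lee_fin big_mkord ltW//.
apply: (@le_lt_trans _ _ (\sum_(i < n) `|F (t i) - F (s i)|)).
  by apply: ler_sum => i _; exact: ler_norm.
have tst : trivIset setT (fun k => `]s k, t k[%classic).
  move=> i j _ _ [x [xi xj]]; apply: tJ => //; exists x.
  by have [_ + _] := st i; have [_ + _] := st j; split; auto.
apply: fd.
- by move=> i; have [] := st i.
- move=> i j _ _ ij; apply/val_inj; exact: tst.
- rewrite -lte_fin; apply: le_lt_trans muU.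
  apply: (@le_trans _ _ (mu (\big[setU/set0]_(i < n) `]s i, t i[%classic))).
    rewrite measure_semi_additive_ord//.
    + rewrite -sumEFin; apply: lee_sum => i _.
      have [/and3P[_ sti _] _ _] := st i.
      rewrite [leRHS](lebesgue_measure_itv `]s i, t i[)/= lte_fin; case: ltP => // tis.
      by rewrite lee_fin subr_le0.
    + by move=> i j _ _ ij; apply/val_inj; exact: tst.
    + by apply: bigsetU_measurable => *; exact: measurable_itv.
  apply: le_measure; rewrite ?inE//.
    by apply: bigsetU_measurable => *; exact: measurable_itv.
  elim/big_ind : _ => [//|X Y XU YU x [/XU|/YU]//|k _ x xk]; have [_ stJ _] := st k.
  have : (U `&` D) x by rewrite UDE; exists k => //; exact: stJ.
  by case.
Qed.

Lemma nondecreasing_ac_density : exists phi : R -> R,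
  mu.-integrable setT (EFin \o phi) /\
  forall x, a <= x <= b -> F x - F a = \int[mu]_(t in `]a, x]) phi t.
Proof.
have [psi [psi0 psifin ipsi psiE]] := radon_nikodym_sigma_finite nuf_dominated.
have psiK : psi = EFin \o (fine \o psi).
  by apply/funext => x /=; rewrite fineK.
exists (fine \o psi); split; first by rewrite -psiK.
move=> x axb; have /andP[ax xb] := axb.
rewrite /Rintegral.
have -> : (\int[mu]_(t in `]a, x]) ((fine \o psi) t)%:E)%E = (F x - F a)%:E.
  have <- : nuf `]a, x]%classic = (F x - F a)%:E.
    change (nu (`]a, x] `&` D) = (F x - F a)%:E).
    rewrite setIidl; last by apply: subset_itvl; rewrite bnd_simp.
    by rewrite nu_oc// /G !cl_id// lexx.
  rewrite psiE; last exact: measurable_itv.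
  by apply: eq_integral => t _ /=; rewrite fineK.
by [].
Qed.

End monotone_density.

Section ac_density.
Context {R : realType}.
Local Notation mu := (@lebesgue_measure R).

Lemma ac_density (a b : R) (f : R -> R) : a <= b -> ac_on a b f ->
  exists phi : R -> R,
  mu.-integrable setT (EFin \o phi) /\
  forall x, a <= x <= b -> f x - f a = \int[mu]_(t in `]a, x]) phi t.
Proof.
move=> ab acf; pose V x := fine (total_variation a x f).
have bvb := ac_on_bounded_variation ab acf.
have acV : ac_on a b V := ac_on_tv ab acf.
have fV x : a <= x <= b -> total_variation a x f \is a fin_num.
  by move=> /andP[ax xb]; apply/bounded_variationP => //; exact: bounded_variationl bvb.
have VD x y : a <= x -> x <= y -> y <= b -> f y - f x <= V y - V x /\ 0 <= V y - V x.
  move=> ax xy yb; have fx : total_variation a x f \is a fin_num by apply: fV; lra.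
  have fxy : total_variation x y f \is a fin_num.
    apply/bounded_variationP => //.
    apply: (@bounded_variationr _ a) => //; apply: bounded_variationl bvb; lra.
  have -> : V y - V x = fine (total_variation x y f).
    by rewrite /V (total_variationD f ax xy) fineD// addrC addKr.
  split.
    apply: le_trans (ler_norm _) _; rewrite -lee_fin fineK//.
    exact: total_variation_ge.
  by rewrite fine_ge0// total_variation_ge0.
have ndV : {in `[a, b] &, nondecreasing_fun V}.
  move=> x y; rewrite !in_itv/= => /andP[ax xb] /andP[ay yb] xy.
  by rewrite -subr_ge0; have [] := VD _ _ ax xy yb.
have ndVf : {in `[a, b] &, nondecreasing_fun (fun x => V x - f x)}.
  move=> x y; rewrite !in_itv/= => /andP[ax xb] /andP[ay yb] xy.
  by have [] := VD _ _ ax xy yb; lra.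
have [phi [iphi phiE]] := nondecreasing_ac_density ab ndV acV.
have [psi [ipsi psiE]] := nondecreasing_ac_density ab ndVf (ac_onB acV acf).
exists (phi \- psi); split;
  first exact: (@integrableB _ _ _ mu setT measurableT (EFin \o phi) (EFin \o psi)).
move=> x axb; rewrite RintegralB//=.
- rewrite -phiE// -psiE//; ring.
- exact: integrableS iphi.
- exact: integrableS ipsi.
Qed.

Lemma near0_shift_itv (a b x : R) : a < x -> x < b ->
  \forall h \near 0^', a < x + h < b.
Proof.
move=> ax xb; have d0 : 0 < Num.min (x - a) (b - x) by rewrite lt_min !subr_gt0 ax.
near=> h.
have : `|h| < Num.min (x - a) (b - x) by near: h; exact: dnbhs0_lt.
by rewrite lt_min !ltr_norml => /andP[/andP[? ?] /andP[? ?]]; apply/andP; split; lra.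
Unshelve. all: by end_near. Qed.

Lemma density_derivative (a b : R) (f phi : R -> R) :
  mu.-integrable setT (EFin \o phi) ->
  (forall x, a <= x <= b -> f x - f a = \int[mu]_(t in `]a, x]) phi t) ->
  {ae mu, forall x, a < x < b -> h^-1 * (f (x + h) - f x) @[h --> 0^'] --> phi x}.
Proof.
move=> iphi fE.
have iphi' y : mu.-integrable [set` Interval (BRight a) (BRight y)] (EFin \o phi).
  exact: integrableS iphi.
have lphi : locally_integrable setT phi.
  rewrite (_ : phi = phi \_ setT); first exact: integrable_locally.
  by apply/funext => y; rewrite patchT ?inE.
have := FTC1 iphi' lphi.
apply: filterS; first exact: (ae_filter_ringOfSetsType mu).
move=> x H /andP[ax xb]; have [dF FE] := H (etrans (lte_fin _ _) ax).
pose F y := \int[mu]_(t in `]a, y]) phi t.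
have qF : h^-1 *: (F (h + x) - F x) @[h --> 0^'] --> phi x.
  rewrite -FE; move: dF; rewrite /derivable.
  under eq_fun do rewrite [_%:A]mulr1.
  exact.
(* [f] and [F] differ by a constant on [[a, b]] only; the quotients agree for small [h] because [x]
   is an interior point. *)
apply: cvg_trans qF; apply: near_eq_cvg.
have nx := near0_shift_itv ax xb.
near=> h.
have /andP[axh xhb] : a < x + h < b by near: h.
rewrite (addrC h x) /F -!fE; last 2 first.
  by rewrite !ltW.
  by rewrite !ltW.
by rewrite opprB addrA subrK.
Unshelve. all: by end_near. 
Qed.

End ac_density.

(** * Complex-valued functions *)

Section complex_modulus.
Context {R : realType}.
Implicit Types z w : R[i].

Lemma normc_norm z : `|z| = (Normc.normc z)%:C.
Proof. by case: z => a b; rewrite normc_def. Qed.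

Lemma normc_ge0 z : 0 <= Normc.normc z.
Proof. by case: z => a b; exact: sqrtr_ge0. Qed.

Lemma normc_le_ReIm z : Normc.normc z <= `|complex.Re z| + `|complex.Im z|.
Proof.
case: z => a b /=; rewrite -[leRHS]ger0_norm ?addr_ge0// -sqrtr_sqr ler_wsqrtr//.
rewrite sqrrD !real_normK ?num_real// addrAC lerDl.
by rewrite mulrn_wge0// mulr_ge0.
Qed.

Lemma Re_le_normc z : `|complex.Re z| <= Normc.normc z.
Proof. by case: z => a b /=; rewrite -sqrtr_sqr ler_wsqrtr// lerDl sqr_ge0. Qed.

Lemma Im_le_normc z : `|complex.Im z| <= Normc.normc z.
Proof. by case: z => a b /=; rewrite -sqrtr_sqr ler_wsqrtr// lerDr sqr_ge0. Qed.

Lemma normcD_le z w : Normc.normc (z + w) <= Normc.normc z + Normc.normc w.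
Proof. exact: le_normcD. Qed.

End complex_modulus.

(** * Derivatives of complex functions of a real variable *)

Section complex_derivative.
Context {R : realType}.
Implicit Types (f g : R -> R[i]) (x : R) (l : R[i]).

(** Unlike an equation on [cderive], this asserts that the derivative exists; the componentwise form
    gives access to the rules for real functions. *)
Definition is_cderive f x l : Prop :=
  is_derive x 1 (fun t => complex.Re (f t)) (complex.Re l) /\
  is_derive x 1 (fun t => complex.Im (f t)) (complex.Im l).

Lemma is_derive_quotient (f : R -> R) x (l : R) :
  is_derive x 1 f l <-> h^-1 * (f (x + h) - f x) @[h --> 0^'] --> l.
Proof.
have E : (fun h => h^-1 *: ((f \o shift x) (h *: 1) - f x)) =
    (fun h => h^-1 * (f (x + h) - f x)).
  by apply/funext => h /=; rewrite [_%:A]mulr1 (addrC x).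
split=> [[df <-]|fl].
  by move: df; rewrite /derivable /derive E.
have df : derivable f x 1 by rewrite /derivable E; apply/cvg_ex; exists l.
by apply: DeriveDef => //; rewrite /derive E; apply/cvg_lim.
Qed.

Lemma is_cderive_cderive f x l : is_cderive f x l -> cderive f x = l.
Proof.
move=> [/is_derive_quotient fR /is_derive_quotient fI]; rewrite /cderive;
  apply: (@cvg_lim (R[i]^o : ptopologicalType)).
  exact: norm_hausdorff.
apply/cvgrPdist_lt => e e0.
(* In the order of [R[i]], being positive includes being real. *)
have eE : e = (complex.Re e)%:C.
  by move: e0; case: e => a b; rewrite ltcE/= => /andP[/eqP -> _].
have e20 : 0 < complex.Re e / 2.
  by move: e0; case: (e) => a b; rewrite ltcE/= => /andP[_ ?]; rewrite divr_gt0.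
move/cvgrPdist_lt/(_ _ e20) : fR => fR; move/cvgrPdist_lt/(_ _ e20) : fI => fI.
near=> h.
have hN0 : h != 0 by near: h; exact: nbhs_dnbhs_neq.
rewrite normc_norm eE ltcR; apply: (le_lt_trans (normc_le_ReIm _)).
rewrite [ltRHS]splitr ltrD//.
  have -> : complex.Re (l - h%:C^-1 * (f (x + h) - f x)) = complex.Re l - h^-1 *
    (complex.Re (f (x + h)) - complex.Re (f x)).
    by rewrite -[h%:C^-1](fmorphV (real_complex R));
      case: (f (x + h)) (f x) (l) => [? ?] [? ?] [? ?] /=; rewrite mul0r subr0.
  by near: h.
have -> : complex.Im (l - h%:C^-1 * (f (x + h) - f x)) = complex.Im l - h^-1 *
  (complex.Im (f (x + h)) - complex.Im (f x)).
  by rewrite -[h%:C^-1](fmorphV (real_complex R));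
    case: (f (x + h)) (f x) (l) => [? ?] [? ?] [? ?] /=; rewrite mul0r addr0.
by near: h.
Unshelve. all: by end_near. Qed.

Lemma is_cderiveM f g x df dg : is_cderive f x df -> is_cderive g x dg ->
  is_cderive (fun t => f t * g t) x (df * g x + f x * dg).
Proof.
move=> [fR fI] [gR gI]; split.
- rewrite (_ : (fun t => _) = (fun t => complex.Re (f t) * complex.Re (g t) -
  complex.Im (f t) * complex.Im (g t))); last first.
    by apply/funext => t; case: (f t) (g t) => [? ?] [? ?].
  apply: is_derive_eq.
  by case: (f x) (g x) (df) (dg) => [? ?] [? ?] [? ?] [? ?] /=;
    rewrite /GRing.scale/=; ring.
- rewrite (_ : (fun t => _) = (fun t => complex.Re (f t) * complex.Im (g t) +
  complex.Im (f t) * complex.Re (g t))); last first.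
    by apply/funext => t; case: (f t) (g t) => [? ?] [? ?].
  apply: is_derive_eq.
  by case: (f x) (g x) (df) (dg) => [? ?] [? ?] [? ?] [? ?] /=;
    rewrite /GRing.scale/=; ring.
Qed.

Lemma near_eq_is_cderive f g x l : (\forall t \near x, f t = g t) ->
  is_cderive f x l -> is_cderive g x l.
Proof.
move=> fg [fR fI]; split.
  by apply: near_eq_is_derive fR => //; near=> t; congr complex.Re; near: t.
by apply: near_eq_is_derive fI => //; near=> t; congr complex.Im; near: t.
Unshelve. all: by end_near. Qed.

End complex_derivative.

Section almost_everywhere_lebesgue.
Context {R : realType}.
Local Notation mu := (@lebesgue_measure R).
Implicit Types P Q : R -> Prop.

Lemma lebesgue_aeW P Q : (forall x, P x -> Q x) ->
  {ae mu, forall x, P x} -> {ae mu, forall x, Q x}.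
Proof. by move=> PQ; exact: (@filterS _ _ (ae_filter_ringOfSetsType mu)). Qed.

Lemma lebesgue_aeI P Q : {ae mu, forall x, P x} -> {ae mu, forall x, Q x} ->
  {ae mu, forall x, P x /\ Q x}.
Proof. exact: (@filterI _ _ (ae_filter_ringOfSetsType mu)). Qed.

End almost_everywhere_lebesgue.

(** * Densities and increments of complex functions *)

Section complex_density.
Context {R : realType}.
Local Notation mu := (@lebesgue_measure R).
Implicit Types (f D : R -> R[i]) (E : set R).

Definition cmeasurable E D : Prop :=
  measurable_fun E (fun x => complex.Re (D x)) /\
  measurable_fun E (fun x => complex.Im (D x)).

Lemma cmeasurable_normc E D : cmeasurable E D ->
  measurable_fun E (fun x => Normc.normc (D x)).
Proof.
move=> [mR mI].
rewrite (_ : (fun x => _) = (fun x => Num.sqrt (complex.Re (D x) ^+ 2 + complex.Im (D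
  x) ^+ 2))); last first.
  by apply/funext => x; case: (D x).
apply: (measurableT_comp (continuous_measurable_fun (@sqrt_continuous R))).
by apply: measurable_funD; exact: measurable_funX.
Qed.

Lemma cmeasurableM E f D : cmeasurable E f -> cmeasurable E D ->
  cmeasurable E (fun x => f x * D x).
Proof.
move=> [fR fI] [DR DI]; split.
- rewrite (_ : (fun x => _) = (fun x => complex.Re (f x) * complex.Re (D x) -
  complex.Im (f x) * complex.Im (D x))); last first.
    by apply/funext => t; case: (f t) (D t) => [? ?] [? ?].
  by apply: measurable_funB; exact: measurable_funM.
- rewrite (_ : (fun x => _) = (fun x => complex.Re (f x) * complex.Im (D x) +
  complex.Im (f x) * complex.Re (D x))); last first.
    by apply/funext => t; case: (f t) (D t) => [? ?] [? ?].
  by apply: measurable_funD; exact: measurable_funM.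
Qed.

Lemma cmeasurableD E f D : cmeasurable E f -> cmeasurable E D ->
  cmeasurable E (fun x => f x + D x).
Proof.
move=> [fR fI] [DR DI]; split.
- rewrite (_ : (fun x => _) = (fun x => complex.Re (f x) + complex.Re (D x)));
  last first.
    by apply/funext => t; case: (f t) (D t) => [? ?] [? ?].
  exact: measurable_funD.
- rewrite (_ : (fun x => _) = (fun x => complex.Im (f x) + complex.Im (D x)));
  last first.
    by apply/funext => t; case: (f t) (D t) => [? ?] [? ?].
  exact: measurable_funD.
Qed.

Lemma abs_continuous_ac_on (a b : R) f (u : R[i] -> R) :
  (forall z w, `|u z - u w| <= Normc.normc (z - w)) ->
  abs_continuous a b f -> ac_on a b (u \o f).
Proof.
move=> u1 acf e e0; have [d d0 fd] := acf e e0; exists d => // n s t st tri std.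
by apply: le_lt_trans (fd n s t st tri std); apply: ler_sum => i _; exact: u1.
Qed.

(** The real and imaginary parts have densities [phi] and [psi]. The factor 2 arises from bounding
    the modulus of the increment by the sum of both parts, and each of [|phi|], [|psi|] by the
    modulus of [D]. *)
Lemma abs_continuous_density (a b : R) f : a <= b -> abs_continuous a b f ->
  exists D, [/\ cmeasurable setT D,
    mu.-integrable setT (fun x => (Normc.normc (D x))%:E),
    forall s t, a <= s -> s <= t -> t <= b ->
      ((Normc.normc (f t - f s))%:E <= \int[mu]_(x in `]s,
        t]) (2 * Normc.normc (D x))%:E)%E &
    {ae mu, forall x, a < x < b -> is_cderive f x (D x)}].
Proof.
move=> ab acf.
have Rsub (z w : R[i]) : complex.Re z - complex.Re w = complex.Re (z - w).
  by case: z w => ? ? [? ?].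
have Isub (z w : R[i]) : complex.Im z - complex.Im w = complex.Im (z - w).
  by case: z w => ? ? [? ?].
have acR : ac_on a b (@complex.Re R \o f).
  by apply: abs_continuous_ac_on => // z w; rewrite Rsub Re_le_normc.
have acI : ac_on a b (@complex.Im R \o f).
  by apply: abs_continuous_ac_on => // z w; rewrite Isub Im_le_normc.
have [phi [iphi phiE]] := ac_density ab acR.
have [psi [ipsi psiE]] := ac_density ab acI.
have mphi : measurable_fun setT phi by move/integrableP : iphi => [/measurable_EFinP].
have mpsi : measurable_fun setT psi by move/integrableP : ipsi => [/measurable_EFinP].
pose D x : R[i] := phi x +i* psi x.
have mD : cmeasurable setT D by split.
have mN : measurable_fun setT (fun x => Normc.normc (D x)) := cmeasurable_normc mD.
exists D; split => //.
- apply: (@le_integrable _ _ _ mu setT measurableT _ ((abse \o (EFin \o phi)) \+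
  (abse \o (EFin \o psi)))%E) => /=.
  + exact/measurable_EFinP.
  + move=> x _; rewrite lee_fin ger0_norm ?normc_ge0// ger0_norm ?addr_ge0//.
    exact: (normc_le_ReIm (D x)).
  + exact: (integrableD measurableT (integrable_abse iphi) (integrable_abse ipsi)).
- move=> s t as_ st tb.
  have incr (h chi : R -> R) : mu.-integrable setT (EFin \o chi) ->
      (forall x, a <= x <= b -> h x - h a = \int[mu]_(y in `]a, x]) chi y) ->
      (`|h t - h s|%:E <= \int[mu]_(x in `]s, t]) `|chi x|%:E)%E.
    move=> ichi hE.
    have -> : h t - h s = (h t - h a) - (h s - h a) by ring.
    rewrite !hE ?as_ ?(le_trans st tb)//; last by rewrite (le_trans as_ st).
    rewrite Rintegral_itvB ?bnd_simp//; last exact: integrableS ichi.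
    rewrite EFin_normr_Rintegral//; last exact: integrableS ichi.
    apply: le_abse_integral => //; apply: measurable_funTS.
    by move/integrableP : ichi => [].
  apply: (@le_trans _ _ (\int[mu]_(x in `]s, t]) (`|phi x| + `|psi x|)%:E)%E).
    apply: (@le_trans _ _ (`|complex.Re (f t - f s)| + `|complex.Im (f t - f s)|)%:E).
      by rewrite lee_fin normc_le_ReIm.
    under eq_integral do rewrite EFinD.
    rewrite ge0_integralD//=; last 2 first.
      by apply/measurable_EFinP/measurableT_comp => //; exact: measurable_funTS.
      by apply/measurable_EFinP/measurableT_comp => //; exact: measurable_funTS.
    rewrite EFinD -Rsub -Isub; apply: leeD.
      exact: (incr (@complex.Re R \o f)).
    exact: (incr (@complex.Im R \o f)).
  apply: ge0_le_integral => //=.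
  + apply/measurable_EFinP; apply: measurable_funD; apply: measurableT_comp => //;
    exact: measurable_funTS.
  + by apply/measurable_EFinP/measurable_funM => //; exact: measurable_funTS.
  + move=> x _; rewrite lee_fin mulr_natl mulr2n.
    by apply: lerD; [exact: (Re_le_normc (D x))|exact: (Im_le_normc (D x))].
- have := lebesgue_aeI (density_derivative iphi phiE) (density_derivative ipsi psiE).
  apply: lebesgue_aeW => x [H1 H2] xab; split; apply/is_derive_quotient;
    [exact: H1|exact: H2].
Qed.

(** Absolute continuity of the integral: the integral of [k] is small over every set of small
    measure, in particular over the union of the given disjoint intervals. *)
Lemma abs_continuous_increments (a b : R) f (k : R -> R) :
  (forall x, 0 <= k x) -> mu.-integrable setT (EFin \o k) ->
  (forall s t, a <= s -> s <= t -> t <= b ->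
    ((Normc.normc (f t - f s))%:E <= \int[mu]_(x in `]s, t]) (k x)%:E)%E) ->
  abs_continuous a b f.
Proof.
move=> k0 ik fk e e0; have [d [d0 kd]] := integral_normr_continuous ik e0.
exists d => // n s t st tri std.
pose A := \big[setU/set0]_(i < n) `]s i, t i[%classic.
have mA : measurable A by apply: bigsetU_measurable => *; exact: measurable_itv.
have mk : measurable_fun setT (EFin \o k) by move/integrableP : ik => [].
have muA : (mu A < d%:E)%E.
  rewrite /A measure_semi_additive_ord//.
  apply: (@le_lt_trans _ _ (\sum_(i < n) (t i - s i)%:E)%E); last first.
    by rewrite sumEFin lte_fin.
  apply: lee_sum => i _; have /and3P[_ sti _] := st i.
  rewrite [leLHS](lebesgue_measure_itv `]s i, t i[)/= lte_fin.
  by case: ltP => //; rewrite lee_fin subr_ge0.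
have := kd A mA muA; rewrite /Rintegral -lte_fin fineK; last first.
  apply: integrable_fin_num => //.
  by apply: (@integrable_abse _ _ _ mu A (EFin \o k)); exact: integrableS ik.
rewrite -lte_fin; apply: le_lt_trans.
under eq_integral do rewrite /= ger0_norm//.
rewrite /A ge0_integral_bigsetU//=.
- rewrite -sumEFin; apply: lee_sum => i _; have /and3P[h1 h2 h3] := st i.
  rewrite (integral_itv_bndo_bndc (f := fun x => (k x)%:E)); first exact: fk.
  exact: measurable_funTS.
- exact: index_enum_uniq.
- exact: sub_trivIset tri.
- exact: measurable_funTS.
- by move=> x _; rewrite lee_fin.
Qed.

End complex_density.

Section complex_absolute_continuity.
Context {R : realType}.
Local Notation mu := (@lebesgue_measure R).
Implicit Types (f g D : R -> R[i]).

Lemma abs_continuous_bounded (a b : R) f : a <= b -> abs_continuous a b f ->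
  exists2 M : R, 0 < M & forall x, a <= x <= b -> Normc.normc (f x) <= M.
Proof.
move=> ab acf; have [D [_ iD fD _]] := abs_continuous_density ab acf.
have i2D : mu.-integrable setT (fun x => (2 * Normc.normc (D x))%:E).
  under eq_fun do rewrite EFinM.
  exact: integrableZl.
have m2D := measurable_int _ i2D.
have fin2D := integrable_fin_num measurableT i2D.
pose J := fine (\int[mu]_x (2 * Normc.normc (D x))%:E)%E.
have D0 x : (0 <= (2 * Normc.normc (D x))%:E)%E by rewrite lee_fin mulr_ge0 ?normc_ge0.
have J0 : 0 <= J by rewrite fine_ge0// integral_ge0.
(* [J] bounds every increment from [a]; the added 1 only makes the bound positive, so that it can be
   divided by. *)
exists (Normc.normc (f a) + J + 1) => [|x /andP[ax xb]].
  by rewrite ltr_wpDl// addr_ge0 ?normc_ge0.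
have fxa : Normc.normc (f x - f a) <= J.
  rewrite -lee_fin fineK//; apply: (le_trans (fD a x (lexx _) ax xb)).
  by apply: ge0_subset_integral => //; exact: measurable_itv.
have := normcD_le (f a) (f x - f a); rewrite addrC subrK; lra.
Qed.

Lemma abs_continuousM (a b : R) f g : a <= b -> abs_continuous a b f ->
  abs_continuous a b g -> abs_continuous a b (fun x => f x * g x).
Proof.
move=> ab acf acg.
have [M M0 fM] := abs_continuous_bounded ab acf.
have [N N0 gN] := abs_continuous_bounded ab acg.
move=> e e0.
have eN : 0 < e / 2 / N by rewrite !divr_gt0.
have eM : 0 < e / 2 / M by rewrite !divr_gt0.
have [d d0 fd] := acf _ eN; have [c c0 gc] := acg _ eM.
exists (Num.min d c) => [|n s t st tri]; first by rewrite lt_min d0.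
rewrite lt_min => /andP[std stc].
apply: (@le_lt_trans _ _ (\sum_(i < n) (N * Normc.normc (f (t i) - f (s i)) + M *
  Normc.normc (g (t i) - g (s i))))).
  apply: ler_sum => i _; have /and3P[as_ st_ tb] := st i.
  rewrite (_ : _ - _ = g (s i) * (f (t i) - f (s i)) + f (t i) * (g (t i) - g (s
    i))); last by ring.
  apply: (le_trans (normcD_le _ _)); rewrite !Normc.normcM; apply: lerD.
    by rewrite ler_wpM2r ?normc_ge0// gN// as_ (le_trans st_).
  by rewrite ler_wpM2r ?normc_ge0// fM// tb (le_trans as_).
rewrite big_split/= -!mulr_sumr (splitr e).
apply: ltrD; rewrite -ltr_pdivlMl// mulrC; [exact: fd|exact: gc].
Qed.

Lemma abs_continuous_cmeasurable (a b : R) f : abs_continuous a b f ->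
  cmeasurable `[a, b]%classic f.
Proof.
move=> acf.
have mu_ (u : R[i] -> R) : (forall z w, `|u z - u w| <= Normc.normc (z - w)) ->
    measurable_fun `[a, b]%classic (u \o f).
  move=> u1; apply: subspace_continuous_measurable_fun; first exact: measurable_itv.
  apply/subspace_continuousP => x; rewrite /= in_itv/= => xab.
  apply/cvgrPdist_lt => e e0.
  have [d d0 fd] := ac_on_continuous (abs_continuous_ac_on u1 acf) e0.
  rewrite near_withinE; apply/nbhs_ballP; exists d => // y xy.
  by rewrite /= in_itv/= => yab; exact: fd.
split; apply: mu_ => z w; [have := Re_le_normc (z - w)|have := Im_le_normc (z - w)];
  by case: z w => ? ? [? ?].
Qed.

Lemma is_cderive_unique f x (l l' : R[i]) :
  is_cderive f x l -> is_cderive f x l' -> l = l'.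
Proof. by move=> /is_cderive_cderive <- /is_cderive_cderive. Qed.

End complex_absolute_continuity.

(** * Dyadic decomposition of the unit interval *)

Section dyadic.
Context {R : realType}.
Local Notation mu := (@lebesgue_measure R).

(** Counted from 0: this is the block selected by [dyadic_part n.+1]. *)
Definition dyadic_itv (n : nat) : set R := `]2^-1 ^+ n.+1, 2^-1 ^+ n]%classic.

Lemma dyadic_itv_measurable n : measurable (dyadic_itv n).
Proof. exact: measurable_itv. Qed.

Lemma dyadic_itv_trivIset : trivIset setT dyadic_itv.
Proof.
have key i j (x : R) : dyadic_itv i x -> dyadic_itv j x -> (i <= j)%N.
  rewrite /dyadic_itv /= !in_itv/= => /andP[ix xi] /andP[jx xj].
  rewrite leqNgt; apply/negP => ji.
  have : (2^-1 : R) ^+ i <= 2^-1 ^+ j.+1.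
    by apply: ler_wiXn2l => //; rewrite invf_le1// ler1n.
  by move=> /(le_trans xi) /(lt_le_trans jx); rewrite ltxx.
by move=> i j _ _ [x [xi xj]]; apply/anti_leq; rewrite !(key _ _ x).
Qed.

Lemma dyadic_itv_bigcup : \bigcup_n dyadic_itv n = `]0, 1]%classic.
Proof.
apply/seteqP; split => x.
  move=> [n _]; rewrite /dyadic_itv /= !in_itv/= => /andP[nx xn].
  rewrite (lt_trans _ nx) ?exprn_gt0//=; apply: (le_trans xn).
  by rewrite exprn_ile1// invf_le1// ler1n.
rewrite /= in_itv/= => /andP[x0 x1].
have ex : exists n, (2^-1 : R) ^+ n < x.
  exists (Num.bound x^-1); rewrite exprVn invf_plt ?posrE ?exprn_gt0//.
  exact: upper_nthrootP.
(* The least exponent whose power of one half is below [x] is at least 1, as [x <= 1]; its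
   predecessor is the index of the block of [x]. *)
have [n nx nmin] := ex_minnP ex.
case: n nx nmin => [|n] nx nmin; first by move: nx; rewrite expr0; lra.
exists n => //; rewrite /dyadic_itv /= in_itv/= nx/=.
by rewrite leNgt; apply/negP => /nmin; rewrite ltnn.
Qed.

(** Each interval [[c n, 1]] has its own density; using the one of index [n] on the block [n] alone
    needs no compatibility between them, and countably many null sets are discarded together. *)
Lemma local_density (f : R -> R[i]) :
  (forall e : R, 0 < e < 1 -> abs_continuous e 1 f) ->
  exists D : R -> R[i], cmeasurable `]0, 1]%classic D /\
    {ae mu, forall x, 0 < x < 1 -> is_cderive f x (D x)}.
Proof.
move=> acf; pose c n : R := 2^-1 ^+ n.+1.
have c01 n : 0 < c n < 1.
  by rewrite exprn_gt0//= exprn_ilt1// invf_lt1// ltr1n.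
have /choice[Dn hD] : forall n, exists D : R -> R[i], cmeasurable setT D /\
    {ae mu, forall x, c n < x < 1 -> is_cderive f x (D x)}.
  move=> n; have /andP[_ /ltW c1] := c01 n.
  by have [D [mD _ _ aeD]] := abs_continuous_density c1 (acf _ (c01 n)); exists D.
(* The index of the block of [x], unique by disjointness; the default 0 occurs only outside []0,
   1]]. *)
pose idx x := xget 0%N [set n | dyadic_itv n x].
have idxE n x : dyadic_itv n x -> idx x = n.
  move=> nx; apply: dyadic_itv_trivIset => //; exists x; split => //.
  by rewrite /idx; case: xgetP => [k -> //|/(_ n)].
pose D x := Dn (idx x) x.
exists D; split.
  rewrite -dyadic_itv_bigcup; split; apply/measurable_fun_bigcup => n;
    try exact: dyadic_itv_measurable.
    apply: (eq_measurable_fun (fun x => complex.Re (Dn n x))).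
      by move=> x; rewrite inE => /idxE xn; rewrite /D xn.
    by apply: measurable_funTS; exact: (hD n).1.1.
  apply: (eq_measurable_fun (fun x => complex.Im (Dn n x))).
    by move=> x; rewrite inE => /idxE xn; rewrite /D xn.
  by apply: measurable_funTS; exact: (hD n).1.2.
have : {ae mu, forall x, forall n, c n < x < 1 -> is_cderive f x (Dn n x)}.
  apply/ae_foralln => n; exact: (hD n).2.
apply: lebesgue_aeW => x Hx /andP[x0 x1].
have : `]0, 1]%classic x by rewrite /= in_itv/= x0 ltW.
rewrite -dyadic_itv_bigcup => -[n _ nx]; rewrite /D (idxE _ _ nx); apply: Hx.
by move: nx; rewrite /dyadic_itv /= in_itv/= => /andP[-> _].
Qed.

End dyadic.

(** * Integral estimates *)

Section Lp_integrals.
Context {R : realType}.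
Local Notation mu := (@lebesgue_measure R).
Implicit Types (f : R -> R[i]) (p : R).

Lemma Lp_normE p f : 0 < p ->
  Lp_norm p%:E f = ((\int[mu]_(x in `[0%R,
    1%R]) ((Normc.normc (f x)) `^ p)%:E) `^ p^-1)%E.
Proof.
move=> p0; rewrite /Lp_norm unlock /=; congr poweR.
rewrite [RHS]integral_mkcond; apply: eq_integral => x _; rewrite !patchE.
case: ifPn => _; last by rewrite abse0 poweR_EFin powR0// gt_eqF.
by rewrite abse_EFin poweR_EFin ger0_norm ?normc_ge0.
Qed.

Lemma Lp_norm_poweR p f : 0 < p ->
  ((Lp_norm p%:E f) `^ p)%E = (\int[mu]_(x in `[0%R,
    1%R]) ((Normc.normc (f x)) `^ p)%:E)%E.
Proof.
move=> p0; rewrite Lp_normE// -poweRrM mulVf ?gt_eqF// poweRe1//.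
by apply: integral_ge0 => x _; rewrite lee_fin powR_ge0.
Qed.

Lemma Lp_norm_lty p f : 0 < p -> cmeasurable `[0, 1]%classic f ->
  (Lp_norm p%:E f < +oo)%E <->
  (\int[mu]_(x in `]0%R, 1%R]) ((Normc.normc (f x)) `^ p)%:E < +oo)%E.
Proof.
move=> p0 mf.
have mfp : measurable_fun (`[0,
  1]%classic : set R) (fun x => (Normc.normc (f x) `^ p)%:E).
  apply/measurable_EFinP; apply: (measurableT_comp (measurable_powR p)).
  exact: cmeasurable_normc.
rewrite integral_itv_obnd_cbnd; last first.
  by apply: measurable_funS mfp => //; apply: subset_itvr; rewrite bnd_simp.
rewrite -Lp_norm_poweR//; split; first exact: poweR_lty.
by apply: lty_poweRy; rewrite gt_eqF.
Qed.

(* [f2] need not be measurable: its integral is then a lower integral *)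
Lemma ae_ge0_le_integral_lower (D : set R) (f1 f2 : R -> \bar R) : measurable D ->
  (forall x, D x -> 0 <= f1 x)%E -> measurable_fun D f1 ->
  (forall x, D x -> 0 <= f2 x)%E ->
  {ae mu, forall x, D x -> (f1 x <= f2 x)%E} ->
  (\int[mu]_(x in D) f1 x <= \int[mu]_(x in D) f2 x)%E.
Proof.
move=> mD f10 mf1 f20 [N [mN muN0 subN]].
(* The exceptional set is removed on the left only. A simple function below [f1] there, and below 0
   elsewhere, is also below [f2], so it competes in the supremum that defines the right-hand
   integral. *)
rewrite (ge0_negligible_integral mN)//.
rewrite ge0_integralE; last by move=> x [Dx _]; exact: f10.
rewrite ge0_integralE//; apply: ereal_sup_le => _ [h hf <-]; exists h => //= x.
apply: (le_trans (hf x)); rewrite !patchE.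
case: ifPn => [/set_mem[Dx Nx]|_]; last first.
  by case: ifPn => // /set_mem /f20.
rewrite mem_set//; apply: contrapT => Nle; apply: Nx; apply: subN => /=.
by move=> /(_ Dx).
Qed.

End Lp_integrals.

(** * Pointwise inequalities between powers *)

Section power_inequalities.
Context {R : realType}.
Implicit Types x p q r v : R.

Lemma powRD_gt0 x p q : 0 < x -> x `^ (p + q) = x `^ p * x `^ q.
Proof. by move=> x0; rewrite powRD// (gt_eqF x0) implybT. Qed.

Lemma le_powR_add1 x q : 0 <= x -> 1 <= q -> x <= x `^ q + 1.
Proof.
move=> x0 q1; have [x1|x1] := leP x 1.
  by apply: (le_trans x1); rewrite lerDr powR_ge0.
rewrite -[leLHS]powRr1//; apply: (@le_trans _ _ (x `^ q)); last by rewrite lerDl.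
by apply: ler_powR => //; exact: ltW.
Qed.

(** Replaces Hölder's inequality. With [Z] the right-hand side, the two factors are at most [Z] to
    the powers [p / v] and [p / r], whose sum is 1. *)
Lemma powR_mul_le p v r x y : 0 < p -> 0 < v -> 0 < r -> p^-1 = v^-1 + r^-1 ->
  0 <= x -> 0 <= y -> (x * y) `^ p <= x `^ v + y `^ r.
Proof.
move=> p0 v0 r0 pvr x0 y0.
pose Z := x `^ v + y `^ r.
have Z0 : 0 <= Z by rewrite addr_ge0 ?powR_ge0.
have xE : x `^ p = (x `^ v) `^ (p / v) by rewrite -powRrM mulrCA divff ?gt_eqF// mulr1.
have yE : y `^ p = (y `^ r) `^ (p / r) by rewrite -powRrM mulrCA divff ?gt_eqF// mulr1.
rewrite powRM// xE yE.
have pvr1 : p / v + p / r = 1 by rewrite -mulrDr -pvr divff// gt_eqF.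
apply: (@le_trans _ _ (Z `^ (p / v) * Z `^ (p / r))); last first.
  rewrite -powRD pvr1 ?powRr1//.
  by rewrite oner_eq0.
apply: ler_pM; rewrite ?powR_ge0//; apply: ge0_ler_powR => //;
  rewrite ?nnegrE ?powR_ge0//.
- by rewrite divr_ge0// ltW.
- by rewrite /Z lerDl powR_ge0.
- by rewrite divr_ge0// ltW.
- by rewrite /Z lerDr powR_ge0.
Qed.

Lemma powRD_le p x y : 0 < p -> 0 <= x -> 0 <= y ->
  (x + y) `^ p <= 2 `^ p * (x `^ p + y `^ p).
Proof.
move=> p0; wlog yx : x y / y <= x => [H x0 y0|x0 y0].
  have /orP[|/H] := le_total y x; first by move=> /H; apply.
  by move=> H1; rewrite addrC (addrC (x `^ p)); exact: H1.
apply: (@le_trans _ _ ((2 * x) `^ p)).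
  by apply: ge0_ler_powR; rewrite ?nnegrE; lra.
by rewrite powRM// ler_wpM2l ?powR_ge0// lerDl powR_ge0.
Qed.

End power_inequalities.

(** * Consequences for integrals over the unit interval *)

Section integral_estimates.
Context {R : realType}.
Local Notation mu := (@lebesgue_measure R).
Local Notation E := (`]0%R, 1%R]%classic : set R).
Implicit Types (G M : R -> R) (p q r v t : R).

Lemma measurable_powR_EFin (D : set R) G p : measurable_fun D G ->
  measurable_fun D (fun x => (G x `^ p)%:E).
Proof. by move=> mG; apply/measurable_EFinP;
  exact: (measurableT_comp (measurable_powR p)). Qed.

(** Hölder's growth rate by scaling: apply [le_powR_add1] to [G x * t ^ (1/r)], divide by
    [t ^ (1/r)] and integrate over a length [t]. Both terms then scale like [t ^ (1 - 1/r)], with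
    constants the integral of [G ^ r] and 1. *)
Lemma integral_powR_bound G r : 1 < r -> (forall x, 0 <= G x) -> measurable_fun E G ->
  (\int[mu]_(x in E) (G x `^ r)%:E < +oo)%E ->
  exists2 C : R, 0 < C & forall t, 0 < t <= 1 ->
    (\int[mu]_(x in `]0%R, t]) (G x)%:E <= (C * t `^ (1 - r^-1))%:E)%E.
Proof.
move=> r1 G0 mG Gr; have r0 : 0 < r by rewrite (lt_trans _ r1).
pose A := (\int[mu]_(x in E) (G x `^ r)%:E)%E.
have A0 : (0 <= A)%E by apply: integral_ge0 => x _; rewrite lee_fin powR_ge0.
exists (fine A + 1) => [|t /andP[t0 t1]]; first by rewrite ltr_wpDl// fine_ge0.
have tE : `]0%R, t]%classic `<=` E by apply: subset_itvl; rewrite bnd_simp.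
have mGt : measurable_fun (`]0%R, t]%classic : set R) G by apply: measurable_funS mG.
have m1 := measurable_powR_EFin r mGt.
apply: (@le_trans _ _ (\int[mu]_(x in `]0%R,
  t]) ((t `^ (1 - r^-1))%:E * (G x `^ r)%:E + (t `^ (- r^-1))%:E))%E).
  apply: ge0_le_integral => //=.
  - by move=> x _; rewrite lee_fin.
  - exact/measurable_EFinP.
  - by apply: emeasurable_funD => //; apply: emeasurable_funM.
  - move=> x _; rewrite -EFinM -EFinD lee_fin.
    have tr0 : 0 <= t `^ (- r^-1) by exact: powR_ge0.
    have trt : t `^ r^-1 * t `^ (- r^-1) = 1.
      by rewrite powRN divff// gt_eqF// powR_gt0.
    have := @le_powR_add1 R (G x * t `^ r^-1) r (mulr_ge0 (G0 x) (powR_ge0 _ _)) (ltW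
      r1).
    rewrite powRM ?powR_ge0// -powRrM mulVf ?gt_eqF// powRr1 ?(ltW t0)// => H.
    have -> : t `^ (1 - r^-1) = t * t `^ (- r^-1).
      by rewrite powRD_gt0// powRr1// ltW.
    have := ler_wpM2r tr0 H; rewrite -mulrA trt mulr1 => /le_trans; apply.
    by rewrite le_eqVlt; apply/orP; left; apply/eqP; ring.
rewrite ge0_integralD//=; last 3 first.
- by move=> x _; rewrite -EFinM lee_fin mulr_ge0 ?powR_ge0.
- by apply: emeasurable_funM.
- by move=> x _; rewrite lee_fin powR_ge0.
rewrite ge0_integralZl_EFin//; last 2 first.
- by move=> x _; rewrite lee_fin powR_ge0.
- exact: powR_ge0.
rewrite integral_cst//= [X in (_ + _ * X)%E](lebesgue_measure_itv `]0%R,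
  t])/= lte_fin t0 sube0 -EFinM.
rewrite mulrDl mul1r EFinD; apply: leeD.
  rewrite mulrC EFinM lee_wpmul2l ?lee_fin ?powR_ge0// fineK ?ge0_fin_numE//.
  apply: ge0_subset_integral => //.
  - exact: measurable_powR_EFin.
  - by move=> x _; rewrite lee_fin powR_ge0.
by rewrite lee_fin addrC powRD_gt0// powRr1// ltW.
Qed.

Lemma integral_ae_bounded G K : 0 <= K -> (forall x, 0 <= G x) -> measurable_fun E G ->
  {ae mu, forall x, E x -> G x <= K} -> forall t, 0 < t <= 1 ->
    (\int[mu]_(x in `]0%R, t]) (G x)%:E <= (K * t)%:E)%E.
Proof.
move=> K0 G0 mG GK t /andP[t0 t1].
have tE : `]0%R, t]%classic `<=` E by apply: subset_itvl; rewrite bnd_simp.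
apply: (@le_trans _ _ (\int[mu]_(x in `]0%R, t]) K%:E)%E).
  apply: ae_ge0_le_integral => //=.
  - by move=> x _; rewrite lee_fin.
  - by apply/measurable_EFinP; exact: measurable_funS mG.
  - by apply: lebesgue_aeW GK => x H /tE; exact: H.
by rewrite integral_cst//= [X in (_ * X)%E](lebesgue_measure_itv `]0%R,
  t])/= lte_fin t0 sube0 -EFinM.
Qed.

Lemma powR_mul_integral M G p v r : 0 < p -> 0 < v -> 0 < r -> p^-1 = v^-1 + r^-1 ->
  (forall x, 0 <= M x) -> (forall x, 0 <= G x) ->
  measurable_fun E M -> measurable_fun E G ->
  (\int[mu]_(x in E) (M x `^ v)%:E < +oo)%E ->
  (\int[mu]_(x in E) (G x `^ r)%:E < +oo)%E ->
  (\int[mu]_(x in E) ((M x * G x) `^ p)%:E < +oo)%E.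
Proof.
move=> p0 v0 r0 pvr M0 G0 mM mG Mv Gr.
have m1 := measurable_powR_EFin v mM; have m2 := measurable_powR_EFin r mG.
apply: (@le_lt_trans _ _ (\int[mu]_(x in E) ((M x `^ v)%:E + (G x `^ r)%:E))%E).
  apply: ge0_le_integral => //=.
  - by move=> x _; rewrite lee_fin powR_ge0.
  - by apply: measurable_powR_EFin; exact: measurable_funM.
  - exact: emeasurable_funD.
  - by move=> x _; rewrite lee_fin; exact: powR_mul_le.
rewrite ge0_integralD//=; [by apply: lte_add_pinfty; [exact: Mv|exact: Gr]|..].
- by move=> x _; rewrite lee_fin powR_ge0.
- by move=> x _; rewrite lee_fin powR_ge0.
Qed.

Lemma ae_bounded_mul_integral M G p K : 0 < p -> 0 <= K ->
  (forall x, 0 <= M x) -> (forall x, 0 <= G x) ->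
  measurable_fun E M -> measurable_fun E G ->
  (\int[mu]_(x in E) (M x `^ p)%:E < +oo)%E ->
  {ae mu, forall x, E x -> G x <= K} ->
  (\int[mu]_(x in E) ((M x * G x) `^ p)%:E < +oo)%E.
Proof.
move=> p0 K0 M0 G0 mM mG Mv GK.
have m1 := measurable_powR_EFin p mM.
apply: (@le_lt_trans _ _ (\int[mu]_(x in E) ((K `^ p)%:E * (M x `^ p)%:E))%E).
  apply: ae_ge0_le_integral => //=.
  - by move=> x _; rewrite lee_fin powR_ge0.
  - by apply: measurable_powR_EFin; exact: measurable_funM.
  - by move=> x _; rewrite -EFinM lee_fin mulr_ge0 ?powR_ge0.
  - exact: emeasurable_funM.
  - apply: lebesgue_aeW GK => x H Ex; rewrite -EFinM lee_fin -powRM// mulrC.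
    by apply: ge0_ler_powR; rewrite ?nnegrE ?mulr_ge0 ?ler_wpM2r ?H// ltW.
rewrite ge0_integralZl_EFin ?powR_ge0//; last by move=> x _; rewrite lee_fin powR_ge0.
by rewrite lte_mul_pinfty// ?lee_fin ?powR_ge0// fin_num_fun.
Qed.

(* If [eps < M s * (C * s `^ w)] near [0], integrating [M `^ v] over
   [s/2, s] gives [eps `^ v * s / 2 <= B * (C * s `^ w) `^ v], impossible
   for small [s] because [1 < w * v]. *)
Lemma powR_lower_bound_not_integrable (M : R -> R) (v w C eps t : R) :
  0 < v -> 0 < w -> 1 < w * v -> 0 < C -> 0 < eps -> 0 < t <= 1 ->
  (forall x, 0 <= M x) -> measurable_fun E M ->
  (\int[mu]_(x in E) (M x `^ v)%:E < +oo)%E ->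
  ~ {ae mu, forall s, 0 < s <= t -> eps <= M s * (C * s `^ w)}.
Proof.
move=> v0 w0 wv1 C0 e0 /andP[t0 t1] M0 mM Mv H.
pose B := fine (\int[mu]_(x in E) (M x `^ v)%:E)%E.
have intM0 : (0 <= \int[mu]_(x in E) (M x `^ v)%:E)%E.
  by apply: integral_ge0 => x _; rewrite lee_fin powR_ge0.
have B0 : 0 <= B by rewrite fine_ge0.
have BE : (\int[mu]_(x in E) (M x `^ v)%:E)%E = B%:E by rewrite fineK// ge0_fin_numE.
have key s : 0 < s <= t -> eps `^ v * (s / 2) <= (B * C `^ v) * s `^ (w * v).
  move=> /andP[s0 st].
  (* On []s / 2, s]] one has [x ^ w <= s ^ w], so [c] is a lower bound for [M] there almost
     everywhere. *)
  pose c := eps / (C * s `^ w).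
  have sw0 : 0 < s `^ w by exact: powR_gt0.
  have c0 : 0 <= c by rewrite divr_ge0 ?mulr_ge0// ltW.
  have sE : (`]s / 2, s]%classic : set R) `<=` E.
    by apply: subset_itv; rewrite bnd_simp; lra.
  have m1 := measurable_powR_EFin v mM.
  have : (\int[mu]_(x in `](s / 2)%R, s]) (c `^ v)%:E <= B%:E)%E.
    apply: (@le_trans _ _ (\int[mu]_(x in `](s / 2)%R, s]) (M x `^ v)%:E)%E).
      apply: ae_ge0_le_integral => //=.
      - by move=> x _; rewrite lee_fin powR_ge0.
      - by move=> x _; rewrite lee_fin powR_ge0.
      - exact: measurable_funS m1.
      - apply: lebesgue_aeW H => x Hx; rewrite in_itv/= => /andP[sx xs].
        have x0 : 0 < x by lra.
        rewrite lee_fin; apply: ge0_ler_powR; rewrite ?nnegrE ?(ltW v0)//.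
        rewrite /c ler_pdivrMr ?mulr_gt0//.
        apply: (le_trans (Hx _)); first by rewrite x0 (le_trans xs).
        rewrite ler_wpM2l// ler_wpM2l ?(ltW C0)//.
        by apply: ge0_ler_powR => //; rewrite ?nnegrE ltW.
    by rewrite -BE; apply: ge0_subset_integral => // x _; rewrite lee_fin powR_ge0.
  rewrite integral_cst//= [X in (_ * X)%E](lebesgue_measure_itv `](s / 2)%R,
    s])/= lte_fin.
  have -> : s / 2 < s by lra.
  rewrite -EFinB -EFinM lee_fin /c (_ : s - s / 2 = s / 2); last by lra.
  have Cs0 : 0 < C * s `^ w by rewrite mulr_gt0.
  rewrite powRM ?invr_ge0 ?(ltW e0) ?(ltW Cs0)//.
  rewrite -[(C * s `^ w)^-1]powR_inv1 ?(ltW Cs0)// -powRrM mulN1r powRN.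
  rewrite powRM ?(ltW C0) ?(ltW sw0)// -powRrM.
  have CS : 0 < C `^ v * s `^ (w * v) by rewrite mulr_gt0// powR_gt0.
  by rewrite mulrAC (ler_pdivrMr _ _ CS) => h; rewrite -mulrA.
(* Divided by [s], [key] reads [eps ^ v / 2 <= B * C ^ v * s ^ a] with [a = w * v - 1 > 0]. Choosing
   [s ^ a <= z] makes the right side at most [eps ^ v / 4]; the added 1 makes [K] positive. *)
pose K := B * C `^ v + 1.
have K0 : 0 < K by rewrite ltr_wpDl// mulr_ge0// powR_ge0.
have ev0 : 0 < eps `^ v by exact: powR_gt0.
pose a := w * v - 1.
have a0 : 0 < a by rewrite subr_gt0.
pose z := (eps `^ v / 4 / K).
have z0 : 0 < z by rewrite !divr_gt0.
pose s := Num.min t (z `^ a^-1).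
have s0 : 0 < s by rewrite lt_min t0 powR_gt0.
have sz : s `^ a <= z.
  apply: (@le_trans _ _ ((z `^ a^-1) `^ a)); last first.
    by rewrite -powRrM mulVf ?gt_eqF// powRr1// ltW.
  by apply: ge0_ler_powR;
    rewrite ?nnegrE ?powR_ge0 ?(ltW a0) ?(ltW s0)// /s ge_min lexx orbT.
have st : 0 < s <= t by rewrite s0 /s ge_min lexx.
have := key s st.
have -> : s `^ (w * v) = s * s `^ a.
  by rewrite /a -[in LHS](subrK 1 (w * v)) powRD_gt0// powRr1 1?mulrC// ltW.
move=> h.
have h2 : (B * C `^ v) * (s * s `^ a) <= K * (s * z).
  apply: ler_pM; rewrite ?mulr_ge0 ?powR_ge0 ?(ltW s0)//; first by rewrite /K lerDl.
  by rewrite ler_wpM2l// ltW.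
have h3 : K * (s * z) = eps `^ v / 4 * s.
  by rewrite /z mulrCA (mulrC K) divfK ?gt_eqF// mulrC.
have : 0 < eps `^ v * s by rewrite mulr_gt0.
lra.
Qed.

End integral_estimates.

Lemma lebesgue_ae_neq {R : realType} (a : R) : {ae @lebesgue_measure R, forall x,
  x <> a}.
Proof.
exists [set a]; split => //; first exact: lebesgue_measure_set1.
by move=> x /= /contrapT.
Qed.

(** * The series hypothesis as an integral bound *)

Section dyadic_estimates.
Context {R : realType}.
Local Notation mu := (@lebesgue_measure R).
Local Notation E := (`]0%R, 1%R]%classic : set R).

Lemma dyadic_sum_integral (M g : R -> R) (N : nat -> \bar R) (w p C : R) :
  0 < p -> 0 < w -> 0 < C ->
  (forall x, 0 <= M x) -> (forall x, 0 <= g x) ->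
  measurable_fun E M -> measurable_fun E g ->
  (forall x, E x -> g x <= C * x `^ w) ->
  (forall n, 0 <= N n)%E ->
  (forall n, \int[mu]_(x in dyadic_itv n) (M x `^ p)%:E <= N n `^ p)%E ->
  (\sum_(0 <= n <oo) ((2 `^ (- (n.+1%:R * w)))%:E * N n) `^ p < +oo)%E ->
  (\int[mu]_(x in E) ((M x * g x) `^ p)%:E < +oo)%E.
Proof.
move=> p0 w0 C0 M0 g0 mM mg gC N0 MN Nsum.
(* On block [n] the bound on [g] is taken at the right end, twice the left end [2 ^ -(n+1)] that
   appears in the series; hence the factor [2 ^ w]. *)
pose K := (C * 2 `^ w) `^ p.
have mI n := @dyadic_itv_measurable R n.
have IE n : @dyadic_itv R n `<=` E by rewrite -dyadic_itv_bigcup; exact: bigcup_sup.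
have mMg : measurable_fun E (fun x => ((M x * g x) `^ p)%:E).
  by apply: measurable_powR_EFin; exact: measurable_funM.
rewrite -dyadic_itv_bigcup ge0_integral_bigcup//; last 3 first.
- by rewrite dyadic_itv_bigcup.
- by move=> x _; rewrite lee_fin powR_ge0.
- exact: dyadic_itv_trivIset.
apply: (@le_lt_trans _ _ (\sum_(0 <= n <oo) (K%:E * ((2 `^ (- (n.+1%:R * w)))%:E * N
  n) `^ p))%E).
  apply: lee_nneseries => [n _ _|n _].
    by apply: integral_ge0 => x _; rewrite lee_fin powR_ge0.
  pose b := C * (2^-1 ^+ n) `^ w.
  have b0 : 0 <= b by rewrite mulr_ge0 ?powR_ge0// ltW.
  apply: (@le_trans _ _ (\int[mu]_(x in dyadic_itv n) ((b `^ p)%:E * (M x `^ p)%:E))%E).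
    apply: ge0_le_integral => //=.
    - exact: mI.
    - by move=> x _; rewrite lee_fin powR_ge0.
    - exact: measurable_funS mMg.
    - apply: emeasurable_funM => //; apply: measurable_powR_EFin.
      exact: measurable_funS mM.
    - move=> x Ix; rewrite -EFinM lee_fin -powRM// mulrC.
      have Ex := IE _ _ Ix.
      apply: ge0_ler_powR;
        rewrite ?nnegrE ?(mulr_ge0 (g0 x) (M0 x)) ?(mulr_ge0 b0 (M0 x)) ?(ltW p0)//.
      rewrite ler_wpM2r//; apply: (le_trans (gC x Ex)); rewrite ler_wpM2l ?(ltW C0)//.
      move: Ix; rewrite /dyadic_itv/= in_itv/= => /andP[nx xn].
      by apply: ge0_ler_powR;
        rewrite ?nnegrE ?exprn_ge0 ?(ltW w0)// (le_trans _ (ltW nx))// exprn_ge0.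
  rewrite ge0_integralZl_EFin ?powR_ge0//; last 3 first.
  - exact: mI.
  - by move=> x _; rewrite lee_fin powR_ge0.
  - by apply: measurable_powR_EFin; exact: measurable_funS mM.
  have bE : b = C * 2 `^ w * 2 `^ (- (n.+1%:R * w)).
    rewrite -mulrA -powRD_gt0// /b; congr (_ * _).
    have -> : w + - (n.+1%:R * w) = - n%:R * w by rewrite -[n.+1%:R]natr1; ring.
    by rewrite powRrM powRN powR_mulrn// exprVn.
  pose c := 2 `^ (- (n.+1%:R * w)).
  have c0 : 0 <= c by exact: powR_ge0.
  have -> : ((c%:E * N n) `^ p = (c `^ p)%:E * N n `^ p)%E.
    by rewrite (@poweRM _ c%:E (N n)) ?lee_fin.
  have bpE : b `^ p = K * c `^ p.
    by rewrite bE -/c powRM ?mulr_ge0 ?powR_ge0// ltW.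
  move: (MN n); move: (integral _ _ _) (N n `^ p)%E => Y X YX.
  rewrite [leRHS]muleA -[in leRHS]EFinM -bpE.
  by apply: lee_wpmul2l YX; rewrite lee_fin powR_ge0.
rewrite nneseriesZl//; last by move=> n _; exact: poweR_ge0.
by rewrite lte_mul_pinfty ?lee_fin ?powR_ge0.
Qed.

Lemma dyadic_itvE n : @dyadic_itv R n =
  `]2 ^ (- n.+1%:Z), 2 ^ (- n.+1%:Z + 1)]%classic.
Proof.
rewrite /dyadic_itv -!exprnN (_ : - n.+1%:Z + 1 = - n%:Z);
  last by rewrite -addn1 PoszD opprD subrK.
by rewrite -exprnN !exprVn.
Qed.

(** Meant for [f] equal to [cderive m], whose measurability is not assumed. Only this direction is
    needed, and for it the norm on the right may be a lower integral. *)
Lemma dyadic_part_integral (f D : R -> R[i]) (p : R) n : 0 < p ->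
  cmeasurable E D -> {ae mu, forall x, 0 < x < 1 -> f x = D x} ->
  (\int[mu]_(x in dyadic_itv n) (Normc.normc (D x) `^ p)%:E <=
   Lp_norm p%:E (dyadic_part n.+1 f) `^ p)%E.
Proof.
move=> p0 mD fD; rewrite (Lp_norm_poweR _ p0).
have IE : @dyadic_itv R n `<=` E by rewrite -dyadic_itv_bigcup; exact: bigcup_sup.
have I01 : @dyadic_itv R n `<=` `[0, 1]%classic.
  by apply: (subset_trans IE); exact: subset_itv_oc_cc.
have mI := @dyadic_itv_measurable R n.
rewrite -[X in (\int[mu]_(x in X) _ <= _)%E](setIidr I01) integral_mkcondr.
apply: ae_ge0_le_integral_lower => //.
- by move=> x _; rewrite patchE; case: ifPn => // _; rewrite lee_fin powR_ge0.
- apply: measurable_funTS; apply/(measurable_restrictT _ mI).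
  apply: measurable_powR_EFin; apply: cmeasurable_normc.
  by split; [apply: measurable_funS mD.1|apply: measurable_funS mD.2].
- by move=> x _; rewrite lee_fin powR_ge0.
- have := lebesgue_aeI fD (lebesgue_ae_neq 1).
  apply: lebesgue_aeW => x [H x1] _.
  rewrite patchE; case: ifPn => [xI|_]; last by rewrite lee_fin powR_ge0.
  rewrite /dyadic_part -dyadic_itvE indicE xI mulr1 H//.
  have /= := IE _ (set_mem xI); rewrite in_itv/= => /andP[-> xle].
  by rewrite lt_neqAle xle andbT; apply/eqP.
Qed.

End dyadic_estimates.

(** * The multiplier theorem *)

Section multiplier.
Context {R : realType}.
Local Notation mu := (@lebesgue_measure R).
Local Notation E := (`]0%R, 1%R]%classic : set R).

(** For finite [r = q], [1/v = 1/p - 1/q < 1 - 1/q = 1/r'] since [p > 1], which is the third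
    conclusion; for infinite [r] that conclusion is [p > 1] itself. *)
Lemma multiplier_exponents (p r' v : R) (r : \bar R) : 1 < p -> (p%:E < r)%E ->
  (r^-1 + r'%:E^-1 = 1)%E -> (v%:E^-1 = p%:E^-1 - r^-1)%E ->
  [/\ 0 < v, 0 < r'^-1, 1 < r'^-1 * v &
    (r = +oo%E /\ v = p /\ r'^-1 = 1) \/
    exists q, [/\ r = q%:E, 1 < q, r'^-1 = 1 - q^-1 & p^-1 = v^-1 + q^-1]].
Proof.
move=> p1 pr rr' vE.
have p0 : 0 < p by rewrite (lt_trans _ p1).
(* The extended inverse of 0 is infinite, so the two equations themselves exclude [r' = 0] and
   [v = 0]. *)
have r'0 : r' != 0.
  apply/eqP => r'0; move: rr'; rewrite r'0 inve0.
  by case: r pr vE => [q| |] // _ _; rewrite ?inver ?invey; try case: ifP.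
have v0 : v != 0.
  apply/eqP => v0; move: vE; rewrite v0 inve0 inver gt_eqF//.
  case: r pr rr' => [q| |] pr _.
  - by rewrite inver gt_eqF// (lt_trans p0 pr).
  - by rewrite invey sube0.
  - by [].
move: rr' vE; rewrite !inver (negbTE r'0) (negbTE v0) (gt_eqF p0).
case: r pr => [q| |] //.
- rewrite lte_fin => pq; have q1 := lt_trans p1 pq; have q0 := lt_trans p0 pq.
  rewrite inver gt_eqF// -EFinD -EFinB => -[] rE [] vE.
  have wE : r'^-1 = 1 - q^-1 by rewrite -rE; ring.
  have q1' : q^-1 < 1 by rewrite invf_lt1.
  have v0' : 0 < v by rewrite -invr_gt0 vE subr_gt0 ltf_pV2.
  have w0 : 0 < r'^-1 by rewrite wE subr_gt0.
  split => //.
  + rewrite -ltr_pdivrMr// div1r vE wE ltrD2r invf_lt1//.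
  + by right; exists q; split => //; rewrite vE subrK.
- rewrite invey add0e sube0 => _ [] rE [] /invr_inj vE.
  by split; rewrite ?vE ?rE ?mul1r//; left.
Qed.

Lemma ae_unit_itv (P : R -> Prop) :
  {ae mu, forall x, 0 < x < 1 -> P x} -> {ae mu, forall x, E x -> P x}.
Proof.
move=> H; have := lebesgue_aeI H (lebesgue_ae_neq 1).
apply: lebesgue_aeW => x [Px x1]; rewrite /= in_itv/= => /andP[x0 xle].
by apply: Px; rewrite x0 lt_neqAle xle andbT; apply/eqP.
Qed.

(** The density from absolute continuity and the representative from [in_Lp] both equal [cderive g]
    almost everywhere, so [D] inherits the norm bound of the latter. *)
Lemma in_AC_density (r : \bar R) (g : R -> R[i]) : in_AC r g ->
  exists D, [/\ cmeasurable setT D,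
    {ae mu, forall x, 0 < x < 1 -> is_cderive g x (D x)},
    forall t, 0 < t <= 1 ->
      ((Normc.normc (g t))%:E <= 2%:E * \int[mu]_(x in `]0%R,
        t]) (Normc.normc (D x))%:E)%E,
    forall q, 0 < q -> r = q%:E ->
      (\int[mu]_(x in E) (Normc.normc (D x) `^ q)%:E < +oo)%E &
    r = +oo%E -> exists2 K : R, 0 <= K &
      {ae mu, forall x, E x -> Normc.normc (D x) <= K}].
Proof.
move=> [acg g0 [g1 [mR mI gg1 Lg1]]].
have [D [mD iD gD aeD]] := abs_continuous_density ler01 acg.
have mg1 : cmeasurable `[0, 1]%classic g1 by [].
have mND : measurable_fun setT (fun x => Normc.normc (D x)) := cmeasurable_normc mD.
have Dg1 : {ae mu, forall x, E x -> D x = g1 x}.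
  have := lebesgue_aeI (ae_unit_itv aeD) gg1; apply: lebesgue_aeW => x [H1 H2] Ex.
  by rewrite -H2 ?(is_cderive_cderive (H1 Ex))//; exact: subset_itv_oc_cc Ex.
exists D; split => //.
- move=> t /andP[t0 t1]; have := gD 0 t (lexx _) (ltW t0) t1.
  rewrite g0 subr0 => /le_trans; apply.
  under eq_integral do rewrite EFinM.
  rewrite ge0_integralZl_EFin//.
  + by move=> x _; rewrite lee_fin normc_ge0.
  + by apply/measurable_EFinP; exact: measurable_funTS.
- move=> q q0 rq; move: Lg1; rewrite rq => /(Lp_norm_lty q0 mg1).
  apply: le_lt_trans; apply: ae_ge0_le_integral => //=.
  + by move=> x _; rewrite lee_fin powR_ge0.
  + by apply: measurable_powR_EFin; exact: measurable_funTS.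
  + by move=> x _; rewrite lee_fin powR_ge0.
  + apply: measurable_powR_EFin; apply: cmeasurable_normc.
    by split; [apply: measurable_funS mR|apply: measurable_funS mI] => //;
      exact: subset_itv_oc_cc.
  + by apply: lebesgue_aeW Dg1 => x H Ex; rewrite H.
(* For exponent [+oo] the norm is the essential supremum provided that the whole space has positive
   measure, which follows by comparison with []0, 1]]. *)
- move=> ry; move: Lg1; rewrite ry /Lp_norm unlock ifT; last first.
    apply: (@lt_le_trans _ _ (mu `]0%R, 1%R]%classic)).
      by rewrite [ltRHS](lebesgue_measure_itv `]0%R,
        1%R])/= lte_fin ltr01 sube0 lte_fin.
    by apply: le_measure; rewrite ?inE//; exact: measurable_itv.
  set f := (X in ess_sup _ X); move: (ess_sup_ge mu f).
  (* The value [-oo] contradicts [f] being real-valued, at almost every point; a finite [k] has no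
     known sign, whence [|k|]. *)
  case: (ess_sup mu f) => [k| |] // fk _; last first.
    exists 0 => //; apply: lebesgue_aeW fk => x.
    by rewrite leeNy_eq /f/= => /eqP fx; exfalso; move: fx; rewrite patchE; case: ifP.
  exists `|k| => //; have := lebesgue_aeI fk Dg1; apply: lebesgue_aeW => x [H1 H2] Ex.
  rewrite H2//; move: H1; rewrite /f/= patchE mem_set; last exact: subset_itv_oc_cc Ex.
  by rewrite abse_EFin lee_fin ger0_norm ?normc_ge0// => /le_trans; apply;
    exact: ler_norm.
Qed.

End multiplier.

(** * Absolute continuity up to the origin *)

Section product_estimate.
Context {R : realType}.
Local Notation mu := (@lebesgue_measure R).
Local Notation E := (`]0%R, 1%R]%classic : set R).

Lemma cmeasurable_closed (f : R -> R[i]) : cmeasurable E f -> cmeasurable `[0,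
  1]%classic f.
Proof.
have E01 : `[0, 1]%classic = [set 0%R] `|` E by rewrite setU1itv// bnd_simp.
by move=> [fR fI]; split; rewrite E01; apply/measurable_funU => //; split => //;
  exact: measurable_fun_set1.
Qed.

Lemma powR_integrable_le (f : R -> R) (p : R) : 1 <= p -> (forall x, 0 <= f x) ->
  measurable_fun E f ->
  (\int[mu]_(x in E) (f x `^ p)%:E < +oo)%E -> (\int[mu]_(x in E) (f x)%:E < +oo)%E.
Proof.
move=> p1 f0 mf fp; have m1 := measurable_powR_EFin p mf.
apply: (@le_lt_trans _ _ (\int[mu]_(x in E) ((f x `^ p)%:E + 1%:E))%E).
  apply: ge0_le_integral => //=.
  - by move=> x _; rewrite lee_fin.
  - exact/measurable_EFinP.
  - exact: emeasurable_funD.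
  - by move=> x _; rewrite lee_fin le_powR_add1.
rewrite ge0_integralD//=; last by move=> x _; rewrite lee_fin powR_ge0.
apply: lte_add_pinfty => //.
by rewrite integral_cst//= [X in (_ * X)%E](lebesgue_measure_itv `]0%R,
  1%R])/= lte_fin ltr01 sube0 mule1 ltry.
Qed.

Lemma powR_integralD (f g : R -> R) (p : R) : 0 < p ->
  (forall x, 0 <= f x) -> (forall x, 0 <= g x) ->
  measurable_fun E f -> measurable_fun E g ->
  (\int[mu]_(x in E) (f x `^ p)%:E < +oo)%E ->
  (\int[mu]_(x in E) (g x `^ p)%:E < +oo)%E ->
  (\int[mu]_(x in E) ((f x + g x) `^ p)%:E < +oo)%E.
Proof.
move=> p0 f0 g0 mf mg fp gp.
have m1 := measurable_powR_EFin p mf; have m2 := measurable_powR_EFin p mg.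
apply: (@le_lt_trans _ _ (\int[mu]_(x in E) ((2 `^ p)%:E * ((f x `^ p)%:E + (g x `^
  p)%:E)))%E).
  apply: ge0_le_integral => //=.
  - by move=> x _; rewrite lee_fin powR_ge0.
  - by apply: measurable_powR_EFin; exact: measurable_funD.
  - by apply: emeasurable_funM => //; exact: emeasurable_funD.
  - by move=> x _; rewrite -EFinD -EFinM lee_fin powRD_le.
have p00 x : (0 <= (f x `^ p)%:E)%E by rewrite lee_fin powR_ge0.
have p01 x : (0 <= (g x `^ p)%:E)%E by rewrite lee_fin powR_ge0.
rewrite ge0_integralZl_EFin ?powR_ge0//; last 2 first.
- by move=> x _; exact: adde_ge0.
- exact: emeasurable_funD.
apply: lte_mul_pinfty; rewrite ?lee_fin ?powR_ge0//.
rewrite ge0_integralD//=; exact: (lte_add_pinfty fp gp).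
Qed.

(* Points [s] near [0] where [h s] is small carry the bound
   [|h t - h s| <= \int_s^t 2 |D|] up to [s = 0]. *)
Lemma abs_continuous_extend (h D : R -> R[i]) :
  h 0 = 0 ->
  (forall e : R, 0 < e < 1 -> abs_continuous e 1 h) ->
  cmeasurable E D ->
  {ae mu, forall x, 0 < x < 1 -> is_cderive h x (D x)} ->
  (\int[mu]_(x in E) (Normc.normc (D x))%:E < +oo)%E ->
  (forall e t : R, 0 < e -> 0 < t <= 1 ->
     exists2 s, 0 < s <= t & Normc.normc (h s) <= e) ->
  abs_continuous 0 1 h.
Proof.
move=> h0 ach mD aeD iD small.
(* Extended by 0, since [abs_continuous_increments] wants integrability on the whole line. *)
pose k := (fun x => 2 * Normc.normc (D x)) \_ E.
have k0 x : 0 <= k x by rewrite /k patchE; case: ifP => // _;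
  rewrite mulr_ge0 ?normc_ge0.
have mE : measurable E by exact: measurable_itv.
have m2 : measurable_fun E (fun x => 2 * Normc.normc (D x)).
  by apply: measurable_funM => //; exact: cmeasurable_normc.
have mk : measurable_fun setT k by apply/(measurable_restrictT _ mE).
have kE x : E x -> k x = 2 * Normc.normc (D x) by move=> Ex; rewrite /k patchE mem_set.
have ik : mu.-integrable setT (EFin \o k).
  apply/integrableP; split; first exact/measurable_EFinP.
  under eq_integral do rewrite /= ger0_norm//.
  have -> : (\int[mu]_x (k x)%:E = 2%:E * \int[mu]_(x in E) (Normc.normc (D x))%:E)%E.
    rewrite -ge0_integralZl_EFin//; last 2 first.
    - by move=> x _; rewrite lee_fin normc_ge0.
    - by apply/measurable_EFinP; exact: cmeasurable_normc.
    rewrite [RHS]integral_mkcond; apply: eq_integral => x _.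
    by rewrite /k !patchE; case: ifP.
  by rewrite lte_mul_pinfty.
have inc s t : 0 < s -> s <= t -> t <= 1 ->
    ((Normc.normc (h t - h s))%:E <= \int[mu]_(x in `]s, t]) (k x)%:E)%E.
  move=> s0 st t1; move: (st); rewrite le_eqVlt => /predU1P[->|st'].
    by rewrite subrr Normc.normc0; apply: integral_ge0 => x _; rewrite lee_fin.
  have s1 : s < 1 by exact: lt_le_trans t1.
  have s01 : 0 < s < 1 by rewrite s0.
  (* The density [D'] depends on [s]; uniqueness of derivatives identifies it with [D] almost
     everywhere, so one [k] serves for all [s]. *)
  have [D' [mD' _ hD' aeD']] := abs_continuous_density (ltW s1) (ach s s01).
  apply: (le_trans (hD' s t (lexx _) st t1)).
  have stE : (`]s, t]%classic : set R) `<=` E by apply: subset_itv;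
    rewrite bnd_simp// ltW.
  apply: ae_ge0_le_integral => //=.
  - by move=> x _; rewrite lee_fin mulr_ge0 ?normc_ge0.
  - apply/measurable_EFinP; apply: measurable_funM => //.
    by apply: measurable_funTS; exact: cmeasurable_normc.
  - by move=> x _; rewrite lee_fin.
  - by apply/measurable_EFinP; exact: measurable_funTS.
  - have := lebesgue_aeI (lebesgue_aeI aeD aeD') (lebesgue_ae_neq 1).
    apply: lebesgue_aeW => x [[H1 H2] x1] xst; rewrite lee_fin kE; last exact: stE.
    move: xst; rewrite in_itv/= => /andP[sx xt].
    have xlt1 : x < 1 by rewrite lt_neqAle (le_trans xt t1) andbT; apply/eqP.
    by rewrite (is_cderive_unique (H1 _) (H2 _))// ?xlt1 ?sx// (lt_trans s0).
apply: (abs_continuous_increments k0 ik) => s t.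
rewrite le_eqVlt => /predU1P[<-|s0] st t1; last exact: inc.
rewrite h0 subr0; move: st; rewrite le_eqVlt => /predU1P[<-|t0].
  by rewrite h0 Normc.normc0; apply: integral_ge0 => x _; rewrite lee_fin.
apply/lee_addgt0Pr => e e0.
have t01 : 0 < t <= 1 by rewrite t0.
have [u /andP[u0 ut] hu] := small e t e0 t01.
apply: (@le_trans _ _ ((Normc.normc (h t - h u))%:E + (Normc.normc (h u))%:E)%E).
  by rewrite -EFinD lee_fin; have := normcD_le (h t - h u) (h u); rewrite subrK.
apply: leeD; last by rewrite lee_fin.
apply: (le_trans (inc u t u0 ut t1)).
apply: ge0_subset_integral => //=.
- by apply/measurable_EFinP; exact: measurable_funTS.
- by move=> x _; rewrite lee_fin.
- by apply: subset_itvr; rewrite bnd_simp ltW.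
Qed.

End product_estimate.

Theorem theorem6 (R : realType) (p : R) (r : \bar R) (r' v : R) (m : R -> R[i])
  (p_gt1 : 1 < p)
  (p_lt_r : (p%:E < r)%E)
  (r'_conj : (r^-1 + r'%:E^-1 = 1)%E)
  (v_def : (v%:E^-1 = p%:E^-1 - r^-1)%E)
  (m_cont : {within `]0, 1]%classic, continuous (m : R -> R[i]^o)})
  (m_Lv : in_Lp v%:E m)
  (m_ac : forall e : R, 0 < e < 1 -> abs_continuous e 1 m)
  (m_sum : (\sum_(1 <= n <oo)
      (((2 `^ (- (n%:R / r')))%R)%:E * Lp_norm p%:E (dyadic_part n (cderive m)))
        `^ p < +oo)%E) :
  is_multiplier r p%:E m.
Proof.
have p0 : 0 < p by rewrite (lt_trans _ p_gt1).
have [v0 w0 wv exps] := multiplier_exponents p_gt1 p_lt_r r'_conj v_def.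
set w := r'^-1 in w0 wv exps.
split => // g gAC.
have [Dg [mDg aeDg gDg gq ginf]] := in_AC_density gAC.
have acg : abs_continuous 0 1 g by case: gAC.
case: m_Lv => m1 [m1R m1I mm1 Lm1].
have [Dm [mDm aeDm]] := local_density m_ac.
pose E : set R := `]0%R, 1%R]%classic.
have mE : measurable E by exact: measurable_itv.
have E01 : E `<=` `[0, 1]%classic by exact: subset_itv_oc_cc.
have mm1E : cmeasurable E m1.
  by split; [apply: measurable_funS m1R|apply: measurable_funS m1I].
have mgE : cmeasurable E g.
  have [h1 h2] := abs_continuous_cmeasurable acg.
  by split; [apply: measurable_funS h1|apply: measurable_funS h2].
have mDgE : cmeasurable E Dg by split; apply: measurable_funTS;
  [exact: mDg.1|exact: mDg.2].
pose M x := Normc.normc (m1 x); pose G x := Normc.normc (Dg x).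
have M0 x : 0 <= M x by exact: normc_ge0.
have G0 x : 0 <= G x by exact: normc_ge0.
have mM : measurable_fun E M by exact: cmeasurable_normc.
have mG : measurable_fun E G by exact: cmeasurable_normc.
have Mv : (\int[@lebesgue_measure R]_(x in E) (M x `^ v)%:E < +oo)%E.
  by apply/(Lp_norm_lty v0 (conj m1R m1I)).
have [[C C0 GC] MG] : (exists2 C : R, 0 < C & forall t, 0 < t <= 1 ->
      (\int[@lebesgue_measure R]_(x in `]0%R, t]) (G x)%:E <= (C * t `^ w)%:E)%E) /\
    (\int[@lebesgue_measure R]_(x in E) ((M x * G x) `^ p)%:E < +oo)%E.
  (* The only place where infinite and finite [r] are treated apart; both yield the growth [t ^ w]
     and the integrability of [m g']. *)
  case: exps => [[ry [vp w1]]|[q [rq q1 wE pvq]]].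
    have [K K0 GK] := ginf ry; split; last first.
      by apply: (ae_bounded_mul_integral p0 K0 M0 G0 mM mG _ GK); rewrite -vp;
        exact: Mv.
    exists (K + 1) => [|t t01]; first by rewrite ltr_wpDl.
    apply: (le_trans (integral_ae_bounded K0 G0 mG GK t01)).
    have /andP[t0 _] := t01.
    by rewrite lee_fin w1 powRr1 ?(ltW t0)// ler_wpM2r ?(ltW t0)// lerDl.
  have q0 : 0 < q by exact: lt_trans q1.
  have Gq := gq _ q0 rq; split.
    by rewrite wE; exact: integral_powR_bound.
  exact: (powR_mul_integral p0 v0 q0 pvq M0 G0 mM mG Mv Gq).
pose C2 := 2 * C.
have C20 : 0 < C2 by rewrite mulr_gt0.
have gC t : 0 < t <= 1 -> Normc.normc (g t) <= C2 * t `^ w.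
  move=> t01; rewrite -lee_fin; apply: (le_trans (gDg t t01)).
  by rewrite /C2 -mulrA EFinM; apply: lee_wpmul2l; [rewrite lee_fin|exact: GC].
(* The product rule with measurable representatives in place of [m] and of both derivatives. *)
pose h1 x := Dm x * g x + m1 x * Dg x.
have mh1 : cmeasurable E h1.
  by apply: cmeasurableD; exact: cmeasurableM.
pose S x := Normc.normc (Dm x) * Normc.normc (g x).
have S0 x : 0 <= S x by rewrite mulr_ge0 ?normc_ge0.
have mS : measurable_fun E S by apply: measurable_funM; exact: cmeasurable_normc.
have Sp : (\int[@lebesgue_measure R]_(x in E) (S x `^ p)%:E < +oo)%E.
  have mDmN := cmeasurable_normc mDm; have mgN := cmeasurable_normc mgE.
  have gCE x : E x -> Normc.normc (g x) <= C2 * x `^ w.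
    by rewrite /E/= in_itv/=; exact: gC.
  pose N n := Lp_norm p%:E (dyadic_part n.+1 (cderive m)).
  have N0 n : (0 <= N n)%E by rewrite /N Lp_normE// poweR_ge0.
  apply: (dyadic_sum_integral p0 w0 C20 (fun x => normc_ge0 (Dm x))
    (fun x => normc_ge0 (g x)) mDmN mgN gCE N0).
    move=> n; apply: dyadic_part_integral => //.
    by apply: lebesgue_aeW aeDm => x H x01; exact/is_cderive_cderive/H.
  (* The series starts at 1 and the blocks at 0: term [n + 1] belongs to block [n]. *)
  rewrite -(nneseries_addn 1) in m_sum; last by move=> n; exact: poweR_ge0.
  apply: le_lt_trans m_sum; apply: lee_nneseries => [n _ _|n _].
    exact: poweR_ge0.
  by rewrite addn1.
have h1p : (\int[@lebesgue_measure R]_(x in E) (Normc.normc (h1 x) `^ p)%:E < +oo)%E.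
  have := powR_integralD p0 S0 (fun x => mulr_ge0 (M0 x) (G0 x)) mS (measurable_funM
    mM mG) Sp MG.
  apply: le_lt_trans; apply: ge0_le_integral => //=.
  - by move=> x _; rewrite lee_fin powR_ge0.
  - by apply: measurable_powR_EFin; exact: cmeasurable_normc.
  - by apply: measurable_powR_EFin; apply: measurable_funD => //;
    exact: measurable_funM.
  - move=> x _; rewrite lee_fin.
    apply: ge0_ler_powR;
      rewrite ?nnegrE ?(ltW p0) ?normc_ge0 ?addr_ge0 ?mulr_ge0 ?normc_ge0//.
    by rewrite /S /M /G -!Normc.normcM; exact: normcD_le.
have aeh : {ae @lebesgue_measure R, forall x, 0 < x < 1 ->
  is_cderive (mult_op m g) x (h1 x)}.
  have := lebesgue_aeI (lebesgue_aeI aeDm aeDg) mm1;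
    apply: lebesgue_aeW => x [[H1 H2] H3] x01.
  have /andP[x0 x1] := x01.
  apply: (@near_eq_is_cderive _ (fun t => m t * g t)).
    near=> t; rewrite /mult_op gt_eqF//; near: t; exact: lt_nbhsr.
  by rewrite /h1 -(H3 _) ?/= ?in_itv/= ?(ltW x0) ?(ltW x1)//; apply: is_cderiveM;
    [exact: H1|exact: H2].
have ach e : 0 < e < 1 -> abs_continuous e 1 (mult_op m g).
  move=> e01; have /andP[e0 e1] := e01.
  have acge : abs_continuous e 1 g.
    move=> z z0; have [d d0 gd] := acg z z0; exists d => // n s t st; apply: gd => i.
    by have /and3P[h1' -> ->] := st i; rewrite (le_trans (ltW e0)).
  move=> z z0; have [d d0 fd] := abs_continuousM (ltW e1) (m_ac _ e01) acge z0.
  exists d => // n s t st tri std; apply: le_lt_trans (fd n s t st tri std).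
  apply: ler_sum => i _; have /and3P[h1' h2 h3] := st i.
  by rewrite /mult_op !gt_eqF// ?(lt_le_trans e0)// (le_trans h1').
split.
- apply: (@abs_continuous_extend _ _ h1) => //.
  + by rewrite /mult_op eqxx.
  + apply: (powR_integrable_le (ltW p_gt1)) h1p => [x|]; first exact: normc_ge0.
    exact: cmeasurable_normc.
  (* If the product exceeded [e] on all of []0, t]], the growth bound on [g] would give
     [e <= M s * (C2 * s ^ w)] almost everywhere there, [M] being the modulus of [m] almost
     everywhere. *)
  + move=> e t e0 t01; apply: contrapT => H.
    apply: (powR_lower_bound_not_integrable v0 w0 wv C20 e0 t01 M0 mM Mv).
    apply: lebesgue_aeW mm1 => s Hs /andP[s0 st].
    have s1 : s <= 1 by have /andP[_] := t01; exact: le_trans.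
    have : e <= Normc.normc (mult_op m g s).
      by rewrite leNgt; apply/negP => he; apply: H; exists s; rewrite ?s0// ltW.
    move=> /le_trans; apply.
    rewrite /mult_op gt_eqF// Normc.normcM Hs/= ?in_itv/= ?(ltW s0)//.
    by rewrite ler_wpM2l ?normc_ge0// gC// s0.
- by rewrite /mult_op eqxx.
- have mh : cmeasurable `[0, 1]%classic h1 by exact: cmeasurable_closed.
  exists h1; split; [exact: mh.1|exact: mh.2| |exact/(Lp_norm_lty p0 mh)].
  have := lebesgue_aeI (ae_unit_itv aeh) (lebesgue_ae_neq 0).
  apply: lebesgue_aeW => x [H x0]; rewrite /= in_itv/= => /andP[xge0 xle1].
  apply: is_cderive_cderive; apply: H.
  by rewrite /= in_itv/= xle1 andbT lt_neqAle xge0 andbT eq_sym; apply/eqP.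
Unshelve. all: by end_near. Qed.
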